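(* Let $\mathcal G=(\mathcal V,\mathcal E)$ be a finite connected planar graph (with a fixed planar embedding) with dual $\mathcal G^*$, and let $U:\mathbb Z\to\mathbb R$ be an annealed Gaussian interaction. Let $n$ be the random height function distributed by $\mathbb P^{U,\mathcal G^*}$, and let $\theta:\mathcal V\to[-\pi,\pi)$ be its dual $O(2)$ spin field, distributed by $\mathbb P^{O(2),U,\mathcal G}$. Then for any pair of vertices $x\ne y$, any preselected oriented simple path $\gamma_{yx}$ in $\mathcal G$ from $y$ to $x$, any oriented edge $e=(x,x')$ such that $x'$ is not in $\gamma_{yx}$, and any $q\in\mathbb Z+\frac12$, $$\mathbb E^{O(2),U,\mathcal G}\big[\cos(\theta_x-\theta_y)\big]\ \ge\ \mathbb P^{U,\mathcal G^*}\big[A^q_{\gamma_{yx},e}\big].$$ Furthermore, the inequality holds also with the fixed $q$ replaced by $\widetilde q(n)$, for any function $\widetilde q$ with values in $\mathbb Z+\frac12$ which is determined by the pair $\{n(x^+),n(x^-)\}$ of values of $n$ on the two faces sharing the edge $e$ ($x^+$ to the left of $e$, $x^-$ to its right); that is, with $A^q_{\gamma_{yx},e}$ replaced by the set of those $n$ for which the defining condition of $A^q_{\gamma_{yx},e}$ holds with $q=\widetilde q(n)$.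
   Context: Annealed Gaussian interaction: a function $U:\mathbb Z\to\mathbb R$ for which there is a finite non-negative Borel measure $\mu_U$ on $[0,\infty)$ with $e^{-U(q)}=\int_{[0,\infty)}e^{-\frac12\lambda q^2}\,d\mu_U(\lambda)$ for all $q\in\mathbb Z$. It is assumed that $\sum_{m\in\mathbb Z}e^{-U(m)}<\infty$, so that the measures below are well defined. Height function: the vertices of $\mathcal G^*$ are the faces of $\mathcal G$ (including the outer face), and each edge of $\mathcal G$ gives a dual edge joining the two faces it borders. $\mathbb P^{U,\mathcal G^*}$ is the probability measure on functions $n$ from faces to $\mathbb Z$ vanishing on the outer face, with weights proportional to $\prod e^{-U(n_f-n_{f'})}$, the product being over dual edges $\{f,f'\}$. Dual spin model: $\mathbb P^{O(2),U,\mathcal G}$ is the probability measure on $\theta\in[-\pi,\pi)^{\mathcal V}$ with density (w.r.t. Lebesgue measure) proportional to $\prod_{\{u,v\}\in\mathcal E}G_U(\theta_u-\theta_v)$, where $G_U(\varphi)=\sum_{m\in\mathbb Z}\exp(-im\varphi-U(m))$, which is positive when $U$ is an annealed Gaussian interaction. Level lines: for $q\in\mathbb Z+\frac12$, an oriented edge of $\mathcal G$ is a $q$-edge if $n<q$ on the face to its right and $n>q$ on the face to its left. At each vertex the incoming and outgoing $q$-edges alternate in the cyclic order; each incoming $q$-edge is continued by the first outgoing $q$-edge met when rotating counterclockwise about the vertex starting from the incoming edge, i.e. starting on its right side. This decomposes the $q$-edges into oriented non-crossing contours. A $q$-path is a segment of consecutive $q$-edges of such a contour. The event $A^q_{\gamma_{yx},e}$: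 there is a $q$-path $\kappa^q_{xy}$ which begins with the oriented edge $e$ and terminates at $y$, such that the concatenation $\gamma_{yx}\circ\kappa^q_{xy}$ is a simple loop of orientation $\mathrm{sgn}(q)$, where counterclockwise loops are positively oriented and clockwise loops negatively oriented. *)

(* Defs.v *)
From HB Require Import structures.
From mathcomp Require Import all_boot all_order all_algebra.
From mathcomp Require Import complex.
From mathcomp Require Import all_classical all_reals all_analysis.

Set Implicit Arguments.
Unset Strict Implicit.
Unset Printing Implicit Defensive.

Import Order.TTheory GRing.Theory Num.Theory.
Import numFieldNormedType.Exports.

Local Open Scope ring_scope.

(* A finite connected graph embedded in the plane, given by its rotation      *)
(* system.  A dart is an oriented edge and [rev] reverses it; [rot] sends a   *)
(* dart to the next dart out of the same vertex in counterclockwise order, so *)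
(* the vertices are the orbits of [rot].  Arriving along [d] and keeping the  *)
(* face on its left, the boundary of that face continues with the dart that   *)
(* precedes [rev d] counterclockwise, so the faces are the orbits of          *)
(* [finv rot \o rev].  Euler's formula says that the surface is the sphere,   *)
(* and the choice of [outer] turns it into the plane.  Loops and multiple     *)
(* edges are permitted.  The graph with one vertex and no edge is excluded,   *)
(* for it has no dart to represent its face.                                  *)
Record plane_graph := PlaneGraph {
  vert : finType;
  dart : finType;
  face : finType;
  source : dart -> vert;
  left : dart -> face;
  rev : dart -> dart;
  rot : dart -> dart;
  outer : face;
  rev_invol : involutive rev;
  rev_neq : forall d, rev d != d;
  rot_inj : injective rot;
  sourceP : forall d d', fconnect rot d d' = (source d == source d');
  leftP : forall d d', fconnect (finv rot \o rev) d d' = (left d == left d');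
  left_surj : forall f, exists d, left d = f;
  vert_connected : forall u v,
    connect (fun u' v' => [exists d, (source d == u') && (source (rev d) == v')])
      u v;
  euler : (#|vert| + #|face| = #|dart|./2 + 2)%N
}.

Section Paths.
Variable G : plane_graph.
Implicit Types (u v : vert G) (d : dart G) (p l : seq (dart G)) (f g : face G).

Definition target d : vert G := source (rev d).

Definition right d : face G := left (rev d).

Fixpoint walk u p v : bool :=
  if p is d :: p' then (source d == u) && walk (target d) p' v else u == v.

Definition walk_verts u p : seq (vert G) := u :: map target p.

Definition simple_path u p v : bool := walk u p v && uniq (walk_verts u p).

Definition simple_loop u l : bool :=
  [&& l != [::], walk u l u, uniq (map target l) & all (fun d => rev d \notin l) l].

(* Two faces lie in the same component of the complement of the closed curve  *)
(* [l] when they are joined by a chain of faces adjacent across edges that do *)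
(* not belong to [l]; the exterior of [l] is the component of [outer].        *)
Definition exterior l f : bool :=
  connect (fun g g' => [exists d, [&& d \notin l, rev d \notin l,
                                      left d == g & right d == g']])
    (outer G) f.

Definition counterclockwise l : bool :=
  all (fun d => ~~ exterior l (left d) && exterior l (right d)) l.

Definition clockwise l : bool :=
  all (fun d => exterior l (left d) && ~~ exterior l (right d)) l.

Definition loop_orientation l : int :=
  if counterclockwise l then 1 else if clockwise l then -1 else 0.

End Paths.

Definition height (G : plane_graph) : Type :=
  {n : {ffun face G -> int} | n (outer G) == 0}.

Definition half_integer (q : rat) : Prop :=
  exists k : int, q = k%:~R + 2%:R^-1.

Section LevelLines.
Variable G : plane_graph.
Implicit Types (n : height G) (q : rat) (d e : dart G) (p : seq (dart G)).

Definition q_edge n q d : bool :=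
  ((val n (right d))%:~R < q) && (q < (val n (left d))%:~R).

(* The orbit lists the darts out of [target d] counterclockwise, starting     *)
(* just after [rev d], that is, on the right-hand side of [d].  It contains a *)
(* q-edge when [d] is one, so the default value is then not used.             *)
Definition q_next n q d : dart G :=
  head d [seq d' <- orbit (@rot G) (rot (rev d)) | q_edge n q d'].

Definition q_path n q e p : bool :=
  all (q_edge n q) (e :: p) && fpath (q_next n q) e p.

(* [gamma] leads from [y] to the source of [e], and the q-path is [e :: p].   *)
Definition level_event (gamma : seq (dart G)) e (y : vert G) q n : Prop :=
  exists p : seq (dart G),
    [/\ q_path n q e p,
        target (last e p) = y,
        simple_loop y (gamma ++ e :: p) &
        loop_orientation (gamma ++ e :: p) = sgz q].

End LevelLines.

Section Measures.
Variable R : realType.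
Implicit Types (U : int -> R) (G : plane_graph).

Definition annealed_gaussian U : Prop :=
  exists mu : {finite_measure set (measurableTypeR R) -> \bar R},
    forall q : int, (expR (- U q))%:E =
      (\int[mu]_(lam in `[0%R, +oo[%classic)
         (expR (- (2%:R^-1 * lam * q%:~R ^+ 2)))%:E)%E.

(* [froots rev] picks one dart for each edge.  The products over the edges do *)
(* not depend on the choice, as an annealed Gaussian interaction is even.     *)
Definition height_weight U G (n : height G) : R :=
  \prod_(d in froots (@rev G)) expR (- U (val n (left d) - val n (right d))).

Definition height_prob U G (A : set (height G)) : R :=
  fine (\esum_(n in A) (height_weight U n)%:E)%E /
  fine (\esum_(n in [set: height G]) (height_weight U n)%:E)%E.

Definition cexp (z : R[i]) : R[i] :=
  ((expR (complex.Re z) * cos (complex.Im z)) +i*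
   (expR (complex.Re z) * sin (complex.Im z)))%C.

(* The sum over all integers of an absolutely summable family. *)
Definition sumZ (f : int -> R) : R :=
  limn (fun N => \sum_(k < N.*2.+1) f (k%:Z - N%:Z)).

Definition csumZ (f : int -> R[i]) : R[i] :=
  (sumZ (fun m => complex.Re (f m)) +i* sumZ (fun m => complex.Im (f m)))%C.

Definition spin_G U (phi : R) : R[i] :=
  csumZ (fun m => cexp (- ('i%C * (m%:~R * phi)%:C%C) - (U m)%:C%C)).

(* [spin_G U] is real valued, see [spin_G_real] below. *)
Definition spin_density U G (theta : vert G -> R) : R :=
  \prod_(d in froots (@rev G))
    complex.Re (spin_G U (theta (source d) - theta (target d))).

(* Lebesgue integral of [F] over [-pi, pi)^s, in the coordinates listed in    *)
(* [s], the other coordinates being those of [theta]; the library has no      *)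
(* n-fold product of measures, so it is written as an iterated integral.      *)
Fixpoint spin_integral (V : finType) (s : seq V) (F : (V -> R) -> R)
    (theta : V -> R) : R :=
  if s is v :: s' then
    (\int[@lebesgue_measure R]_(t in `[(- pi)%R, pi%R[%classic)
       spin_integral s' F [eta theta with v |-> t])%R
  else F theta.

Definition spin_expectation U G (F : (vert G -> R) -> R) : R :=
  spin_integral (enum (vert G)) (fun theta => F theta * spin_density U theta)
    (fun=> 0) /
  spin_integral (enum (vert G)) (@spin_density U G) (fun=> 0).

Lemma annealed_gaussian_even U : annealed_gaussian U ->
  forall q, U (- q) = U q.
Proof.
move=> [mu hmu] q; apply: oppr_inj; apply: expR_inj; apply: EFin_inj.
have qN : (- q)%:~R ^+ 2 = q%:~R ^+ 2 :> R by rewrite mulrNz sqrrN.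
by have := hmu (- q); rewrite qN -hmu.
Qed.

Lemma sumZ_odd (f : int -> R) : (forall m, f (- m) = - f m) -> sumZ f = 0.
Proof.
move=> fN; rewrite /sumZ.
have -> : (fun N : nat => \sum_(k < N.*2.+1) f (k%:Z - N%:Z)) = (fun=> 0).
  apply/funext => N; apply/eqP.
  rewrite -[_ == 0](mulrn_eq0 _ 2) mulr2n addr_eq0; apply/eqP.
  rewrite -sumrN (reindex_inj rev_ord_inj) /=; apply: eq_bigr => k _.
  rewrite -fN opprB; congr f.
  have H (j : nat) : (j <= N.*2)%N -> (N.*2 - j)%:Z - N%:Z = N%:Z - j%:Z.
    by move=> jN; rewrite -subzn// -addnn PoszD addrAC addrK.
  by rewrite subSS H // -ltnS.
exact: lim_cst.
Qed.

Lemma spin_G_real U phi : annealed_gaussian U ->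
  complex.Im (spin_G U phi) = 0.
Proof.
move=> /annealed_gaussian_even Ue; apply: sumZ_odd => m.
rewrite /= Ue mulrNz !(mul0r, mul1r, mulr0, mulr1, addr0, add0r, subr0,
  oppr0, mulNr, mulrN, opprK).
by rewrite sinN mulrN opprK.
Qed.

End Measures.

(* Main.v *)
Require Import Defs.
From HB Require Import structures.
From mathcomp Require Import all_boot all_order all_algebra.
From mathcomp Require Import complex.
From mathcomp Require Import all_classical all_reals all_analysis.
From mathcomp Require Import measurable_realfun.
From mathcomp Require Import ring lra zify.

Set Implicit Arguments.
Unset Strict Implicit.
Unset Printing Implicit Defensive.

Import Order.TTheory GRing.Theory Num.Theory.
Import numFieldNormedType.Exports.

Local Open Scope ring_scope.
Local Open Scope classical_set_scope.

(* Expand each factor of the spin density in its Fourier series and integrate *)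
(* out the angles: up to a common factor, the numerator of the spin           *)
(* expectation is the total weight of the integer currents with source [y]    *)
(* and sink [x], and the denominator that of the sourceless ones. By Euler's  *)
(* formula the sourceless currents are the gradients of the height functions, *)
(* and subtracting the indicator of [gamma] from such gradients gives         *)
(* currents of the first kind. Hence it suffices that this subtraction does   *)
(* not decrease the total weight of the event.                                *)
(*                                                                            *)
(* Condition on the level line kappa and on the heights of the faces which it *)
(* explores: these are > q on one side of the loop formed by [gamma] and      *)
(* kappa, and < q on the other one. Shifting one side of the loop by one unit *)
(* moves the subtraction into the boundary condition, where the upper values  *)
(* are lowered by one and so get closer to the lower ones. For Gaussian       *)
(* weights this does not decrease the partition function: the four functions  *)
(* theorem reduces the claim to constant upper values, for which it follows   *)
(* from a reflection and the four functions theorem again. The general case   *)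
(* follows by integrating over the Gaussian couplings, edge by edge.          *)

(** * The four functions theorem *)

(** Both sides of the inequality are read off from currents, the integer functions on [edge G].
    [spin_integral_total] writes the two spin integrals as total weights of currents with prescribed
    divergence. By [divergence_exact] every sourceless current is a gradient, so the denominator is
    at most the partition function of the heights ([total_sourceless_le]). By [divergence_cut] a
    gradient minus [cut gamma] has the divergence prescribed in the numerator, so the weights of
    these currents sum to at most the numerator ([cut_sum_le]). What remains is [level_sum_le]: on
    the event, subtracting [cut gamma] does not lower the total weight.

    The event is a disjoint union of classes of height functions which agree on the faces explored
    by the level line, since these heights determine the line ([q_path_agree], [q_path_uniq]). Write
    $q=h-\frac12$. By [touched_sides] the explored heights are at least $h$ on the left side of the
    loop and at most $h-1$ on the other. Lowering the left side by one therefore absorbs [cut gamma]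
    and only changes the boundary values ([loop_class_le], [class_le]). [Zc_lower] compares the two
    boundary conditions for Gaussian weights, and [gauss_mixture_le] passes to $e^{-U}$. *)

Section FourFunctions.
Variables (R : realFieldType) (I : finType) (disp : Order.disp_t).
Variable T : finOrderType disp.
Implicit Types (x y : {ffun I -> T}) (f : {ffun I -> T} -> R).

Definition fmax x y : {ffun I -> T} := [ffun i => Order.max (x i) (y i)].
Definition fmin x y : {ffun I -> T} := [ffun i => Order.min (x i) (y i)].

(** Adding to each pair $(s,t)$ its swap reduces the claim to four products with $a,b\le c$ and, by
    the hypothesis at $(s,s)$ and $(t,t)$, $ab\le cd$. Then $(c-a)(c-b)\ge0$ gives $c(a+b)\le
    c^2+ab\le c(c+d)$. *)
Lemma four_functions_chain (g1 g2 g3 g4 : T -> R) :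
  (forall t, 0 <= g1 t) -> (forall t, 0 <= g2 t) ->
  (forall t, 0 <= g3 t) -> (forall t, 0 <= g4 t) ->
  (forall s t, g1 s * g2 t <= g3 (Order.max s t) * g4 (Order.min s t)) ->
  (\sum_t g1 t) * (\sum_t g2 t) <= (\sum_t g3 t) * (\sum_t g4 t).
Proof.
move=> g1_ge0 g2_ge0 g3_ge0 g4_ge0 le12_34.
have cross (a b c d : R) : 0 <= a -> 0 <= b -> 0 <= c -> 0 <= d ->
    a <= c -> b <= c -> a * b <= c * d -> a + b <= c + d.
  move=> a0 b0 c0 d0 ac bc abcd.
  have [c_gt0|] := ltP 0 c; last lra.
  rewrite -(ler_pM2l c_gt0); nra.
rewrite !big_distrlr /= !pair_big /=.
rewrite -(ler_pM2r (ltr0n R 2)) !mulr_natr !mulr2n.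
have swap (h : T -> T -> R) :
    \sum_(p : T * T) h p.1 p.2 = \sum_(p : T * T) h p.2 p.1.
  rewrite (reindex_inj (h := fun p : T * T => (p.2, p.1))) //=.
  by move=> [a b] [c d] [] -> ->.
rewrite {2}(swap (fun s t => g1 s * g2 t)) {2}(swap (fun s t => g3 s * g4 t)).
rewrite -!big_split /=; apply: ler_sum => -[s t] _ /=.
wlog le_st : s t / (s <= t)%O.
  move=> H; have /orP[|] := le_total s t; first exact: H.
  by move=> /H; rewrite [X in X <= _ -> _]addrC [X in _ <= X -> _]addrC.
rewrite [X in _ <= X]addrC.
have h1 := le12_34 s t; have h2 := le12_34 t s.
move: h1 h2; rewrite (max_r le_st) (min_l le_st) (max_l le_st) (min_r le_st).
move=> h1 h2.
apply: cross; rewrite ?mulr_ge0//.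
have hs := le12_34 s s; have ht := le12_34 t t.
rewrite maxxx minxx in hs; rewrite maxxx minxx in ht.
have := ler_pM (mulr_ge0 (g1_ge0 s) (g2_ge0 s)) (mulr_ge0 (g1_ge0 t) (g2_ge0 t)) hs ht.
by congr (_ <= _); ring.
Qed.

Let fixed_off (s : seq I) x : pred {ffun I -> T} :=
  fun y => [forall i, (i \notin s) ==> (y i == x i)].

Let upd x i t : {ffun I -> T} := [ffun j => if j == i then t else x j].

Let sum_fixed_off_cons i s x f : i \notin s ->
  \sum_(y | fixed_off (i :: s) x y) f y =
  \sum_t \sum_(y | fixed_off s (upd x i t) y) f y.
Proof.
move=> is_; rewrite (partition_big (fun y => y i) predT) //=.
apply: eq_bigr => t _; apply: eq_bigl => y.
apply/andP/forallP => [[/forallP H /eqP <-] j|H].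
  rewrite ffunE; apply/implyP => js; case: (eqVneq j i) => [->//|ji].
  by have /implyP := H j; rewrite inE negb_or ji js; apply.
split; last by have /implyP := H i; rewrite is_ ffunE eqxx; apply.
apply/forallP => j; rewrite inE negb_or; apply/implyP => /andP[ji js].
by have /implyP := H j; rewrite js ffunE (negPf ji); apply.
Qed.

(* Ahlswede and Daykin *)
Lemma four_functions f1 f2 f3 f4 :
  (forall x, 0 <= f1 x) -> (forall x, 0 <= f2 x) ->
  (forall x, 0 <= f3 x) -> (forall x, 0 <= f4 x) ->
  (forall x y, f1 x * f2 y <= f3 (fmax x y) * f4 (fmin x y)) ->
  (\sum_x f1 x) * (\sum_x f2 x) <= (\sum_x f3 x) * (\sum_x f4 x).
Proof.
move=> f1_ge0 f2_ge0 f3_ge0 f4_ge0 le12_34.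
(* Induction on the list [s] of free coordinates: the others are frozen at [x] and [y], and freeing
   one more is an instance of [four_functions_chain]. *)
suff H s x y : uniq s ->
    (\sum_(z | fixed_off s x z) f1 z) * (\sum_(z | fixed_off s y z) f2 z) <=
    (\sum_(z | fixed_off s (fmax x y) z) f3 z) *
    (\sum_(z | fixed_off s (fmin x y) z) f4 z).
  (* With [T] empty there is no base point: the sums are empty if [I] has an element, and have a
     single term otherwise. *)
  case: (pickP (@predT T)) => [t0 _|T0]; last first.
    have sum0 f : #|I| != 0%N -> \sum_x f x = 0.
      move=> I0; apply: big1 => x _; case: (pickP (@predT I)) => [i _|I_].
        by have := T0 (x i).
      by move: I0; rewrite (eq_card0 I_).
    have [I0|I0] := eqVneq #|I| 0%N; last by rewrite !(sum0 _ I0) mul0r.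
    have Ie (i : I) : False by have := fintype0 i I0.
    pose x0 : {ffun I -> T} := [ffun i => False_rect T (Ie i)].
    have xE x : x = x0 by apply/ffunP => i; case: (Ie i).
    have sum1 f : \sum_x f x = f x0.
      by rewrite (bigD1 x0)//= big1 ?addr0// => y; rewrite (xE y) eqxx.
    rewrite !sum1 (le_trans (le12_34 x0 x0))//.
    by rewrite (xE (fmax _ _)) (xE (fmin _ _)).
  have sumE f x : \sum_(z | fixed_off (enum I) x z) f z = \sum_z f z.
    by apply: eq_bigl => z; apply/forallP => i; rewrite mem_enum.
  by have := H (enum I) [ffun=> t0] [ffun=> t0] (enum_uniq _); rewrite !sumE.
elim: s x y => [|i s IH] x y /=.
  have sum_nil f z : \sum_(z' | fixed_off [::] z z') f z' = f z.
    rewrite (big_pred1 z) // => z'; apply/forallP/eqP => [H|-> i]; last by rewrite eqxx implybT.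
    by apply/ffunP => j; have /eqP := H j.
  by rewrite !sum_nil.
move=> /andP[is_ s_uniq]; rewrite !sum_fixed_off_cons//.
apply: four_functions_chain => [t|t|t|t|t t']; try by rewrite sumr_ge0.
have := IH (upd x i t) (upd y i t') s_uniq.
congr (_ <= _ * _); apply: eq_bigl => z; congr fixed_off;
  by apply/ffunP => j; rewrite !ffunE; case: ifP.
Qed.

End FourFunctions.

(** * Sums over integer configurations *)

Section Esum.
Variables (R : realType) (T : choiceType).
Implicit Types (A B : set T) (f g : T -> R).

Lemma subset_le_esum A B (a : T -> \bar R) : A `<=` B ->
  (\esum_(x in A) a x <= \esum_(x in B) a x)%E.
Proof.
move=> AB; apply: ge_ereal_sup => _ [X [finX XA] <-]; apply: ereal_sup_ubound.
by exists X => //; split=> // x /XA/AB.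
Qed.

Lemma esum_sup_le A f (M : \bar R) :
  (forall X, finite_set X -> X `<=` A -> ((\sum_(x \in X) f x)%:E <= M)%E) ->
  (\esum_(x in A) (f x)%:E <= M)%E.
Proof.
move=> H; apply: ge_ereal_sup => _ [X [finX XA] <-].
by rewrite fsumEFin//; exact: H.
Qed.

Lemma esum_fin_num A f : (forall x, 0 <= f x) ->
  (\esum_(x in A) (f x)%:E < +oo)%E -> \esum_(x in A) (f x)%:E \is a fin_num.
Proof. by move=> f0 ?; rewrite ge0_fin_numE// esum_ge0// => x _; rewrite lee_fin. Qed.

End Esum.

Section Box.
Variables (R : realType) (I : finType).
Implicit Types (f : {ffun I -> int} -> R) (N : nat).

(** The cube $[-N,N]^I$, encoded by a power of a finite chain so that [four_functions] applies to
    it. *)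
Definition box N (x : {ffun I -> 'I_(N.*2.+1)}) : {ffun I -> int} :=
  [ffun i => (x i)%:Z - N%:Z].

Definition boxsum f N : R := \sum_(x : {ffun I -> 'I_(N.*2.+1)}) f (box x).

Definition total f : R := fine (\esum_(x in [set: {ffun I -> int}]) (f x)%:E).

Definition summableR f : Prop :=
  (\esum_(x in [set: {ffun I -> int}]) (f x)%:E < +oo)%E.

Lemma box_inj N : injective (@box N).
Proof.
move=> x y /ffunP xy; apply/ffunP => i; apply: val_inj.
by have := xy i; rewrite !ffunE => /addIr [].
Qed.

Lemma mem_box (x : {ffun I -> int}) N : (forall i, (`|x i| <= N)%N) ->
  exists y, @box N y = x.
Proof.
move=> xN.
have lt_i i : (`|(x i + N%:Z)%R|%N < N.*2.+1)%N by have := xN i; lia.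
exists [ffun i => Ordinal (lt_i i)]; apply/ffunP => i; rewrite !ffunE /=.
by have := xN i; lia.
Qed.

Lemma boxsumE f N : (forall x, 0 <= f x) ->
  (boxsum f N)%:E = (\esum_(x in range (@box N)) (f x)%:E)%E.
Proof.
move=> f0; rewrite esum_image; last by move=> x y _ _; exact: box_inj.
have finT : finite_set [set: {ffun I -> 'I_(N.*2.+1)}].
  exact: finite_finset.
rewrite esum_fset//; last by move=> i _; rewrite lee_fin.
rewrite fsumEFin//; apply: (congr1 EFin).
rewrite /boxsum fsbig_seq; last exact: index_enum_uniq.
by apply: eq_fsbigl; apply/seteqP; split=> // x _; rewrite /= mem_index_enum.
Qed.

Lemma boxsum_le_esum f N : (forall x, 0 <= f x) ->
  ((boxsum f N)%:E <= \esum_(x in [set: {ffun I -> int}]) (f x)%:E)%E.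
Proof. by move=> f0; rewrite boxsumE//; exact: subset_le_esum. Qed.

Lemma finite_sub_box (X : set {ffun I -> int}) : finite_set X ->
  exists N0, forall N, (N0 <= N)%N -> X `<=` range (@box N).
Proof.
move=> /finite_seqP[s ->].
exists (\max_(x <- s) \max_i `|x i|)%N => N N0N x /= xs.
have [i|y yx] := @mem_box x N; last by exists y.
apply: leq_trans N0N; apply: (leq_trans (@leq_bigmax _ (fun i => `|x i|%N) i)).
by rewrite (big_rem x)//= leq_maxl.
Qed.

Lemma fsum_le_boxsum f (X : set {ffun I -> int}) : (forall x, 0 <= f x) ->
  finite_set X -> exists N0, forall N, (N0 <= N)%N ->
    \sum_(x \in X) f x <= boxsum f N.
Proof.
move=> f0 finX; have [N0 N0P] := finite_sub_box finX; exists N0 => N /N0P XN.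
rewrite -lee_fin -fsumEFin// boxsumE//; apply: esum_ge.
by exists X.
Qed.

Lemma esum_le_boxsum f (M : \bar R) : (forall x, 0 <= f x) ->
  (forall N, ((boxsum f N)%:E <= M)%E) ->
  (\esum_(x in [set: {ffun I -> int}]) (f x)%:E <= M)%E.
Proof.
move=> f0 fM; apply: esum_sup_le => X finX _.
have [N /(_ N (leqnn N)) XN] := fsum_le_boxsum f0 finX.
by rewrite (le_trans _ (fM N))// lee_fin.
Qed.

Lemma boxsum_cvg f : (forall x, 0 <= f x) -> summableR f ->
  boxsum f N @[N --> \oo] --> total f.
Proof.
move=> f0 sf; have ffin := esum_fin_num f0 sf.
apply/cvgrPdist_le => eps eps0.
have : (\esum_(x in [set: {ffun I -> int}]) (f x)%:E - eps%:E <
        \esum_(x in [set: {ffun I -> int}]) (f x)%:E)%E.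
  by rewrite lteBlDr// lteDl// lte_fin.
move=> /ereal_sup_gt[_ [X [finX _] <-]]; rewrite fsumEFin// => ltX.
have [N0 N0P] := fsum_le_boxsum f0 finX.
near=> N.
have NN0 : (N0 <= N)%N by near: N; exact: nbhs_infty_ge.
have le_tot : boxsum f N <= total f.
  by rewrite -lee_fin fineK//; exact: boxsum_le_esum.
rewrite ger0_norm ?subr_ge0// lerBlDl -lerBlDr.
apply: le_trans (N0P _ NN0); apply: ltW.
by rewrite -lte_fin EFinB fineK.
Unshelve. all: end_near. Qed.

Definition zmax (x y : {ffun I -> int}) : {ffun I -> int} :=
  [ffun i => Num.max (x i) (y i)].
Definition zmin (x y : {ffun I -> int}) : {ffun I -> int} :=
  [ffun i => Num.min (x i) (y i)].

(** The limit of [four_functions] along growing cubes; [box] is increasing in each coordinate, hence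
    commutes with maxima and minima. *)
Lemma four_functions_int f1 f2 f3 f4 :
  (forall x, 0 <= f1 x) -> (forall x, 0 <= f2 x) ->
  (forall x, 0 <= f3 x) -> (forall x, 0 <= f4 x) ->
  summableR f1 -> summableR f2 -> summableR f3 -> summableR f4 ->
  (forall x y, f1 x * f2 y <= f3 (zmax x y) * f4 (zmin x y)) ->
  total f1 * total f2 <= total f3 * total f4.
Proof.
move=> f1_ge0 f2_ge0 f3_ge0 f4_ge0 s1 s2 s3 s4 le12_34.
apply: (ler_cvg_to (cvgM (boxsum_cvg f1_ge0 s1) (boxsum_cvg f2_ge0 s2))
  (cvgM (boxsum_cvg f3_ge0 s3) (boxsum_cvg f4_ge0 s4))).
apply: nearW => N; apply: four_functions => // x y.
apply: (le_trans (le12_34 _ _)); rewrite le_eqVlt; apply/orP; left; apply/eqP.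
have leE i : (x i <= y i)%O = ((x i)%:Z - N%:Z <= (y i)%:Z - N%:Z).
  by rewrite leEord lerD2r lez_nat.
congr (f3 _ * f4 _); apply/ffunP => i; rewrite !ffunE.
  by rewrite !maxEle -leE; case: ifP.
by rewrite !minEle -leE; case: ifP.
Qed.

End Box.

Section SymmetricSums.
Variable R : realType.
Implicit Types f : int -> R.

Definition symsum f N : R := \sum_(k < N.*2.+1) f (k%:Z - N%:Z).

Lemma symsum0 f : symsum f 0 = f 0.
Proof. by rewrite /symsum big_ord1. Qed.

Lemma symsumS f N : symsum f N.+1 = symsum f N + (f N.+1%:Z + f (- N.+1%:Z)).
Proof.
rewrite /symsum doubleS big_ord_recl; rewrite [X in _ + X]big_ord_recr /=.
rewrite addrCA [X in _ + X = _]addrC; congr (_ + (_ + _)).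
- by apply: eq_bigr => i _; congr f; rewrite /= /bump; lia.
- by congr f; rewrite /bump /=; lia.
- by congr f; lia.
Qed.

Lemma symsum_geometric_le f (x : R) : 0 <= x < 1 ->
  (forall m, f m <= x ^+ `|m|%N) -> forall N, symsum f N <= 2 / (1 - x).
Proof.
move=> /andP[x0 x1] fx N.
(* This is $1+2(x+\dots+x^N)$ in closed form, a bound which passes through the induction. *)
suff H : symsum f N <= 2 * (1 - x ^+ N.+1) / (1 - x) - 1.
  apply: le_trans H _; rewrite lerBlDr -subr_ge0.
  have -> : 2 / (1 - x) + 1 - 2 * (1 - x ^+ N.+1) / (1 - x) = 1 + 2 * x ^+ N.+1 / (1 - x).
    by field; rewrite subr_eq0 eq_sym lt_eqF.
  apply: addr_ge0 => //; apply: divr_ge0; last by rewrite subr_ge0 ltW.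
  by apply: mulr_ge0 => //; exact: exprn_ge0.
have x1_neq0 : 1 - x != 0 by rewrite subr_eq0 eq_sym lt_eqF.
elim: N => [|N IH].
  rewrite symsum0 (le_trans (fx _))// absz0 expr0 expr1 mulfK//; lra.
rewrite symsumS.
have h1 := fx N.+1%:Z; have h2 := fx (- N.+1%:Z).
rewrite abszN !absz_nat in h1 h2.
have -> : 2 * (1 - x ^+ N.+2) / (1 - x) - 1 =
    2 * (1 - x ^+ N.+1) / (1 - x) - 1 + (x ^+ N.+1 + x ^+ N.+1).
  by rewrite (exprS x N.+1); field.
by apply: lerD => //; apply: lerD.
Qed.

Lemma symsum_le_esum f : (forall m, 0 <= f m) -> forall N,
  ((symsum f N)%:E <= \esum_(m in [set: int]) (f m)%:E)%E.
Proof.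
move=> f0 N; pose e (k : 'I_(N.*2.+1)) : int := k%:Z - N%:Z.
have e_inj : injective e by move=> i j /addIr [] /val_inj.
rewrite (le_trans _ (@subset_le_esum _ _ (range e) _ _ _))//.
rewrite esum_image; last by move=> i j _ _; exact: e_inj.
have finT : finite_set [set: 'I_(N.*2.+1)] by exact: finite_finset.
rewrite esum_fset//; last by move=> i _; rewrite lee_fin.
rewrite fsumEFin// lee_fin /symsum fsbig_seq; last exact: index_enum_uniq.
rewrite le_eqVlt; apply/orP; left; apply/eqP.
by apply: eq_fsbigl; apply/seteqP; split=> // x _; rewrite /= mem_index_enum.
Qed.

End SymmetricSums.

Section Summability.
Variables (R : realType) (E : finType) (W : E -> int -> R).
Hypothesis W_ge0 : forall d m, 0 <= W d m.

Lemma boxsum_prod N :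
  boxsum (fun m : {ffun E -> int} => \prod_d W d (m d)) N =
  \prod_d symsum (W d) N.
Proof.
rewrite /boxsum /symsum bigA_distr_bigA /=; apply: eq_bigr => x _.
by apply: eq_bigr => d _; rewrite ffunE.
Qed.

Lemma summable_prod (C : E -> R) : (forall d N, symsum (W d) N <= C d) ->
  summableR (fun m : {ffun E -> int} => \prod_d W d (m d)).
Proof.
move=> WC; rewrite /summableR; apply: (@le_lt_trans _ _ (\prod_d C d)%:E).
  apply: esum_le_boxsum => [m|N]; first exact: prodr_ge0.
  rewrite lee_fin boxsum_prod; apply: ler_prod => d _.
  by rewrite WC andbT sumr_ge0.
by rewrite ltry.
Qed.

Variables (F : finType) (l r : E -> F) (f0 : F).
(** Connectedness of the graph with vertices [F] and edges [E]. *)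
Hypothesis connected_lr : forall n : F -> int,
  (forall d, n (l d) = n (r d)) -> forall g, n g = n f0.

Definition grad (n : {ffun F -> int}) : {ffun E -> int} :=
  [ffun d => n (l d) - n (r d)].

Lemma grad_inj (n n' : {ffun F -> int}) : grad n = grad n' -> n f0 = n' f0 ->
  n = n'.
Proof.
move=> /ffunP nn' n0; apply/ffunP => g.
apply/eqP; rewrite -subr_eq0; apply/eqP.
rewrite (@connected_lr (fun g => n g - n' g)) ?n0 ?subrr// => d.
by have := nn' d; rewrite !ffunE; lia.
Qed.

(** Heights pinned at [f0] are determined by their gradients, so a sum over them is dominated by the
    sum over all edge configurations, which factorises for product weights. *)
Lemma pinned_esum_le (A : set {ffun F -> int}) (f : {ffun E -> int} -> R) :
  (forall m, 0 <= f m) ->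
  (forall n n', A n -> A n' -> n f0 = n' f0) ->
  (\esum_(n in A) (f (grad n))%:E <= \esum_(m in [set: {ffun E -> int}]) (f m)%:E)%E.
Proof.
move=> f_ge0 A0; rewrite -(esum_image A grad (fun m => (f m)%:E)).
  exact: subset_le_esum.
by move=> n n' /set_mem An /set_mem An' /grad_inj; apply; exact: A0.
Qed.

End Summability.

(** * Gaussian weights *)

Section GaussianComparison.
Variables (R : realType) (F E : finType) (l r : E -> F) (f0 : F).
Hypothesis connected_lr : forall n : F -> int,
  (forall d, n (l d) = n (r d)) -> forall g, n g = n f0.
Variable lam : E -> R.
Hypothesis lam_gt0 : forall d, 0 < lam d.
(** Heights are prescribed on [D], and the weight keeps the edges of [P]. Any other edge joins two
    faces of [D], so its factor would be constant. *)
Variables (P : pred E) (D : pred F).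
Hypothesis D_f0 : D f0.
Hypothesis D_notP : forall d, ~~ P d -> D (l d) && D (r d).
Implicit Types n b : {ffun F -> int}.

Definition gauss (a : R) (k : int) : R := expR (- (2^-1 * a * k%:~R ^+ 2)).

Lemma gauss_ge0 a k : 0 <= gauss a k.
Proof. exact: expR_ge0. Qed.

(** As $|k|\le k^2$, the terms are dominated by the powers of $e^{-a/2}$. *)
Lemma gauss_symsum a : 0 < a -> exists C, forall N, symsum (gauss a) N <= C.
Proof.
move=> a0; set x := expR (- (2^-1 * a)).
exists (2 / (1 - x)); apply: symsum_geometric_le => [|m].
  by rewrite expR_ge0 -expR0 ltr_expR oppr_lt0 mulr_gt0.
rewrite /gauss /x -expRM_natl ler_expR.
have : (`|m|%N)%:R <= m%:~R ^+ 2 :> R.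
  rewrite natr_absz -rmorphXn ler_int; nia.
by nra.
Qed.

(* A Gaussian factor is log-concave, hence satisfies the lattice condition.   *)
Lemma gauss_lattice a (k k' m m' : int) : 0 < a ->
  gauss a (k - k') * gauss a (m - m') <=
  gauss a (Num.max k m - Num.max k' m') * gauss a (Num.min k m - Num.min k' m').
Proof.
move=> a0; rewrite /gauss -!expRD ler_expR -!opprD lerN2 -!mulrDr.
rewrite ler_pM2l ?mulr_gt0// -!rmorphXn -!rmorphD ler_int.
have [km|km] := leP k m; have [km'|km'] := leP k' m'; nia.
Qed.

Definition agree b n := [forall g, D g ==> (n g == b g)].

Lemma agreeP b n : reflect (forall g, D g -> n g = b g) (agree b n).
Proof.
apply: (iffP forallP) => [H g Dg|H g]; first by apply/eqP; exact: (implyP (H g)).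
by apply/implyP => Dg; rewrite H.
Qed.

Definition cond_weight b n : R :=
  if agree b n then \prod_(d | P d) gauss (lam d) (n (l d) - n (r d)) else 0.

Lemma cond_weight_ge0 b n : 0 <= cond_weight b n.
Proof. by rewrite /cond_weight; case: ifP => // _; apply: prodr_ge0 => d _; exact: gauss_ge0. Qed.

Lemma cond_weight_summable b : summableR (cond_weight b).
Proof.
(* Edges outside [P] have no Gaussian factor; the indicator of their prescribed increment stands in
   for it, which gives a summable product over all edges. *)
pose W d (k : int) : R :=
  if P d then gauss (lam d) k else ((k == b (l d) - b (r d)) : nat)%:R.
have W_ge0 d k : 0 <= W d k by rewrite /W; case: ifP => // _; exact: gauss_ge0.
have WC d : exists C, forall N, symsum (W d) N <= C.
  have [Pd|/negPf Pd] := boolP (P d).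
    by have [C CP] := gauss_symsum (lam_gt0 d); exists C; rewrite /W Pd.
  exists 1 => N; rewrite /symsum /W Pd; set j := b (l d) - b (r d).
  case: (pickP (fun k : 'I_(N.*2.+1) => k%:Z - N%:Z == j)) => [k0 /eqP k0j|nj].
    rewrite (bigD1 k0)//= k0j eqxx big1 ?addr0// => k kk0.
    rewrite -k0j; case: eqP => // /addIr [] /val_inj kE.
    by rewrite kE eqxx in kk0.
  by rewrite big1// => k _; rewrite nj.
have [C CP] := choice WC.
pose A := [set n : {ffun F -> int} | agree b n].
apply: le_lt_trans (summable_prod W_ge0 CP).
apply: le_trans (@pinned_esum_le _ _ _ _ _ f0 connected_lr A _ _ _).
- rewrite [leRHS]esum_mkcond; apply: le_esum => n _.
  rewrite /cond_weight; case: ifP => bn; last first.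
    by case: ifP => // _; rewrite lee_fin; exact: prodr_ge0.
  rewrite ifT ?inE// lee_fin [leRHS](bigID P)/= mulrC.
  rewrite [X in _ <= X * _]big1 ?mul1r; last first.
    move=> d dP; rewrite /W (negPf dP) ffunE.
    have /andP[Dl Dr] := D_notP dP.
    by rewrite !(agreeP _ _ bn)// eqxx.
  rewrite le_eqVlt; apply/orP; left; apply/eqP; apply: eq_bigr => d dP.
  by rewrite /W dP ffunE.
- by move=> m; exact: prodr_ge0.
- by move=> n n' /agreeP nb /agreeP nb'; rewrite nb// nb'.
Qed.

Definition Zc b : R := total (cond_weight b).

Lemma Zc_gt0 b : 0 < Zc b.
Proof.
have s := cond_weight_summable b.
rewrite /Zc /total -lte_fin fineK; last by apply: esum_fin_num => // x; exact: cond_weight_ge0.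
apply: (@lt_le_trans _ _ (\sum_(n \in [set b]) (cond_weight b n)%:E)%E).
  rewrite fsbig_set1 lte_fin /cond_weight ifT; last by apply/agreeP.
  by rewrite prodr_gt0// => d _; exact: expR_gt0.
by apply: esum_ge; exists [set b].
Qed.

(** [four_functions_int], with [gauss_lattice] on every edge; maxima and minima of configurations
    obey the maximum and minimum of the boundary conditions. *)
Lemma Zc_lattice b1 b2 : Zc b1 * Zc b2 <= Zc (zmax b1 b2) * Zc (zmin b1 b2).
Proof.
apply: four_functions_int; try exact: cond_weight_ge0;
  try exact: cond_weight_summable.
move=> x y; rewrite /cond_weight.
have [/agreeP b1x|] := boolP (agree b1 x); last first.
  by move=> _; rewrite mul0r mulr_ge0//; exact: cond_weight_ge0.
have [/agreeP b2y|] := boolP (agree b2 y); last first.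
  by move=> _; rewrite mulr0 mulr_ge0//; exact: cond_weight_ge0.
have -> : agree (zmax b1 b2) (zmax x y).
  by apply/agreeP => g Dg; rewrite !ffunE b1x// b2y.
have -> : agree (zmin b1 b2) (zmin x y).
  by apply/agreeP => g Dg; rewrite !ffunE b1x// b2y.
rewrite -!big_split /=; apply: ler_prod => d _.
by rewrite mulr_ge0 ?gauss_ge0//= !ffunE; exact: gauss_lattice.
Qed.

Lemma Zc_reindex b b' (e : {ffun F -> int} -> {ffun F -> int}) :
  bijective e -> (forall n, cond_weight b (e n) = cond_weight b' n) ->
  Zc b = Zc b'.
Proof.
move=> [e' eK e'K] bb'; rewrite /Zc /total; congr fine.
rewrite (@reindex_esum _ _ _ [set: {ffun F -> int}] _ e); last first.
  split=> // [x y _ _|y _]; first by move/(can_inj eK).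
  by exists (e' y); rewrite ?e'K.
by apply: eq_esum => n _; rewrite bb'.
Qed.

Lemma Zc_shift b (k : int) : Zc [ffun g => b g + k] = Zc b.
Proof.
apply: (@Zc_reindex _ _ (fun n => [ffun g => n g + k])).
  exists (fun n => [ffun g => n g - k]) => n; apply/ffunP => g;
    by rewrite !ffunE ?addrK ?subrK.
move=> n; rewrite /cond_weight.
have -> : agree [ffun g => b g + k] [ffun g => n g + k] = agree b n.
  apply/agreeP/agreeP => H g Dg; have := H g Dg; rewrite !ffunE; lia.
case: ifP => // _; apply: eq_bigr => d _; rewrite !ffunE; congr gauss; lia.
Qed.

Lemma Zc_reflect b (k : int) : Zc [ffun g => k - b g] = Zc b.
Proof.
apply: (@Zc_reindex _ _ (fun n => [ffun g => k - n g])).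
  exists (fun n => [ffun g => k - n g]) => n; apply/ffunP => g;
    by rewrite !ffunE subKr.
move=> n; rewrite /cond_weight.
have -> : agree [ffun g => k - b g] [ffun g => k - n g] = agree b n.
  apply/agreeP/agreeP => H g Dg; have := H g Dg; rewrite !ffunE; lia.
case: ifP => // _; apply: eq_bigr => d _; rewrite !ffunE /gauss.
have -> : k - n (l d) - (k - n (r d)) = - (n (l d) - n (r d)) by lia.
by rewrite rmorphN sqrrN.
Qed.

Lemma eq_Zc b b' : (forall g, D g -> b g = b' g) -> Zc b = Zc b'.
Proof.
move=> bb'; rewrite /Zc; congr total; apply/funext => n.
rewrite /cond_weight; congr (if _ then _ else _).
by apply/agreeP/agreeP => H g Dg; rewrite H// bb'.
Qed.

(* Lowering the upper boundary values by one brings them closer to the lower  *)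
(* ones.  The lattice condition compares [b] with the case where the upper    *)
(* values are all [h]; that case follows from the lattice condition and the   *)
(* reflection which exchanges [h] and [h - 1].                                *)
Lemma Zc_lower (Up : pred F) (h : int) b :
  (forall g, D g -> Up g -> h <= b g) ->
  (forall g, D g -> ~~ Up g -> b g <= h - 1) ->
  Zc b <= Zc [ffun g => b g - (Up g)%:Z].
Proof.
move=> b_up b_dn.
pose bh : {ffun F -> int} := [ffun g => if Up g then h else b g].
pose dn b : {ffun F -> int} := [ffun g => b g - (Up g)%:Z].
pose up b : {ffun F -> int} := [ffun g => b g + (~~ Up g)%:Z].
(* Raising the lower values and lowering the upper ones differ by a global shift. *)
have Zup c : Zc (up c) = Zc (dn c).
  rewrite -(Zc_shift (dn c) 1); congr Zc; apply/ffunP => g; rewrite !ffunE.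
  by case: (Up g) => /=; lia.
(* On [D], the maximum of [b] and [up bh] is [up b], and their minimum is [bh]. *)
have le1 : Zc b * Zc (dn bh) <= Zc (dn b) * Zc bh.
  rewrite -!Zup; apply: (le_trans (Zc_lattice _ _)).
  rewrite le_eqVlt; apply/orP; left; apply/eqP; congr (_ * _); apply: eq_Zc => g Dg;
    rewrite !ffunE; have := b_up g Dg; have := b_dn g Dg;
    by case: (Up g) => /=; lia.
(* On [D], the minimum of [bh] and its reflection at $h-\frac12$ is [dn bh], and their maximum is
   the reflection of [dn bh]. *)
have le2 : Zc bh * Zc bh <= Zc (dn bh) * Zc (dn bh).
  rewrite -{2}(Zc_reflect bh (2 * h - 1)).
  apply: (le_trans (Zc_lattice _ _)).
  rewrite -{1}(Zc_reflect (dn bh) (2 * h - 1)).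
  rewrite le_eqVlt; apply/orP; left; apply/eqP; congr (_ * _); apply: eq_Zc => g Dg;
    rewrite !ffunE; have := b_up g Dg; have := b_dn g Dg;
    by case: (Up g) => /=; lia.
have h1 := Zc_gt0 b; have h2 := Zc_gt0 bh; have h3 := Zc_gt0 (dn bh).
have h4 := Zc_gt0 (dn b).
have le3 : Zc bh <= Zc (dn bh) by nra.
rewrite -(ler_pM2r h3) (le_trans le1)// ler_pM2l//.
Qed.

End GaussianComparison.

(** * Gaussian mixtures *)

Section EsumIntegral.
Variables (R : realType) (disp : measure_display) (X : measurableType disp).
Variables (mu : {measure set X -> \bar R}) (D : set X) (T : countType).
Hypothesis mD : measurable D.
Local Open Scope ereal_scope.

(** [pickle] enumerates [T], and the numbers which encode nothing contribute 0. *)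
Lemma esum_nneseries (A : set T) (a : T -> \bar R) : (forall n, 0 <= a n) ->
  \esum_(n in A) a n =
  \sum_(0 <= i <oo) oapp (fun n => if n \in A then a n else 0) 0 (pickle_inv i).
Proof.
move=> a0; pose a' i := oapp (fun n => if n \in A then a n else 0) 0 (@pickle_inv T i).
have a'0 i : 0 <= a' i by rewrite /a'; case: (pickle_inv i) => //= n; case: (n \in A).
rewrite -/(a' _) nneseries_esumT// esum_mkcond.
transitivity (\esum_(i in range (@pickle T)) a' i).
  rewrite esum_image; last by move=> n n' _ _; exact: (pcan_inj pickleK).
  by apply: eq_esum => n _; rewrite /a' pickleK_inv.
rewrite [LHS]esum_mkcond; apply: eq_esum => i _.
case: ifPn => //; rewrite notin_setE /a' => ni.
case E: (pickle_inv i) => [n|//]; exfalso; apply: ni; exists n => //.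
by have := @pickle_invK T i; rewrite /ocancel E.
Qed.

(** Monotone convergence, carried over from series to sums over a countable type. *)
Lemma integral_esum (A : set T) (f : T -> X -> \bar R) :
  (forall n, measurable_fun D (f n)) ->
  (forall n x, 0 <= f n x) ->
  measurable_fun D (fun x => \esum_(n in A) f n x) /\
  \int[mu]_(x in D) (\esum_(n in A) f n x) =
  \esum_(n in A) \int[mu]_(x in D) f n x.
Proof.
move=> mf f0.
pose g i x := oapp (fun n => if n \in A then f n x else 0) 0 (@pickle_inv T i).
have mg i : measurable_fun D (g i).
  rewrite /g; case: (pickle_inv i) => /= [n|]; last exact: measurable_cst.
  by case: (n \in A) => //; exact: measurable_cst.
have g0 i x : 0 <= g i x.
  by rewrite /g; case: (pickle_inv i) => //= n; case: (n \in A).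
have fg : (fun x => \esum_(n in A) f n x) = (fun x => \sum_(0 <= i <oo) g i x).
  by apply/funext => x; rewrite esum_nneseries.
split.
  by rewrite fg; exact: ge0_emeasurable_sum.
rewrite fg integral_nneseries//.
rewrite esum_nneseries => [|n]; last exact: integral_ge0.
apply: eq_eseriesr => i _; rewrite /g.
case: (pickle_inv i) => /= [n|]; last by rewrite integral0.
by case: (n \in A) => //; rewrite integral0.
Qed.

End EsumIntegral.

Section GaussianMixture.
Variables (R : realType) (U : int -> R) (E : finType) (T : countType).
Variables (A : set T) (x y : T -> E -> int).
Hypothesis hU : annealed_gaussian U.

Lemma measurable_gauss (D : set R) (k : int) :
  measurable_fun D (fun a : R => (gauss a k)%:E).
Proof.
apply/measurable_EFinP; apply: measurable_funTS.
apply: continuous_measurable_fun => a.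
apply: (@continuous_comp _ _ _ (fun a : R => - (2^-1 * a * k%:~R ^+ 2)) expR);
  last exact: continuous_expR.
apply: cvgN; apply: cvgM; last exact: cvg_cst.
by apply: cvgM; [exact: cvg_cst|exact: cvg_id].
Qed.

Let gprod (lam : E -> R) (z : E -> int) : R := \prod_d gauss (lam d) (z d).

Let gprod_ge0 lam z : 0 <= gprod lam z.
Proof. by apply: prodr_ge0 => d _; exact: gauss_ge0. Qed.

(** Both sums are linear in the weight of any one edge, and $e^{-U}$ is a mixture of Gaussian
    weights. Integrating the inequality over one coupling at a time turns every factor into
    $e^{-U}$. *)
Lemma gauss_mixture_le :
  (forall lam : E -> R, (forall d, 0 < lam d) ->
    (\esum_(n in A) (gprod lam (x n))%:E <= \esum_(n in A) (gprod lam (y n))%:E)%E) ->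
  (\esum_(n in A) (\prod_d expR (- U (x n d)))%:E <=
   \esum_(n in A) (\prod_d expR (- U (y n d)))%:E)%E.
Proof.
move=> lt_lam.
(* Gaussian weights decrease in the coupling, so a vanishing one is a limit.  *)
have le_lam lam : (forall d, 0 <= lam d) ->
    (\esum_(n in A) (gprod lam (x n))%:E <= \esum_(n in A) (gprod lam (y n))%:E)%E.
  move=> lam0; apply: esum_sup_le => X finX XA.
  pose lamN N d := lam d + N.+1%:R^-1.
  have le_N N : ((\sum_(n \in X) gprod (lamN N) (x n))%:E <=
      \esum_(n in A) (gprod lam (y n))%:E)%E.
    apply: (@le_trans _ _ (\esum_(n in A) (gprod (lamN N) (x n))%:E)%E).
      by rewrite -fsumEFin//; apply: esum_ge; exists X.
    apply: (le_trans (lt_lam (lamN N) _)) => [d|].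
      by rewrite ltr_wpDl// invr_gt0.
    apply: le_esum => n _; rewrite lee_fin; apply: ler_prod => d _.
    rewrite gauss_ge0/= ler_expR lerN2 ler_wpM2r ?sqr_ge0//.
    by rewrite ler_wpM2l// lerDl.
  have cvg_N : \sum_(n \in X) gprod (lamN N) (x n) @[N --> \oo] -->
      \sum_(n \in X) gprod lam (x n).
    rewrite fsbig_finite//; under eq_fun do rewrite fsbig_finite//.
    apply: cvg_big => [|n _]; first exact: add_continuous.
    apply: cvg_big => [|d _]; first exact: mul_continuous.
    apply: continuous_cvg; first exact: continuous_expR.
    apply: cvgN; apply: cvgM; last exact: cvg_cst.
    apply: cvgM; first exact: cvg_cst.
    rewrite -[X in _ --> X]addr0; apply: cvgD; first exact: cvg_cst.
    exact: cvg_harmonic.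
  case Y: (\esum_(n in A) (gprod lam (y n))%:E)%E => [Y'||].
  - rewrite lee_fin; apply: (ler_cvg_to cvg_N (cvg_cst Y')).
    by apply: nearW => N; rewrite -lee_fin -Y.
  - by rewrite leey.
  - by have := le_N 0%N; rewrite Y.
(* The edges of [s] are already integrated, the others still have a coupling. *)
pose mixed (s : seq E) lam d (k : int) : R :=
  if d \in s then expR (- U k) else gauss (lam d) k.
have mixed_ge0 s lam d k : 0 <= mixed s lam d k.
  by rewrite /mixed; case: ifP => _; exact: expR_ge0.
suff H s lam : (forall d, 0 <= lam d) ->
    (\esum_(n in A) (\prod_d mixed s lam d (x n d))%:E <=
     \esum_(n in A) (\prod_d mixed s lam d (y n d))%:E)%E.
  have := H (enum E) (fun=> 0) (fun=> lexx 0).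
  congr (_ <= _)%E; apply: eq_esum => n _; congr (_%:E);
    by apply: eq_bigr => d _; rewrite /mixed mem_enum.
elim: s lam => [|d0 s IH] lam lam0; first exact: le_lam.
case: (boolP (d0 \in s)) => d0s.
  have -> : mixed (d0 :: s) = mixed s; last exact: IH.
  apply/funext => lam'; apply/funext => d; rewrite /mixed inE.
  by case: eqP => // ->; rewrite d0s.
have [mu muP] := hU.
set I0 : set R := `[0%R, +oo[%classic in muP.
pose h (z : T -> E -> int) n := \prod_(d | d != d0) mixed s lam d (z n d).
have h_ge0 z n : 0 <= h z n by exact: prodr_ge0.
have int_h z : (\esum_(n in A) (\prod_d mixed (d0 :: s) lam d (z n d))%:E =
    \int[mu]_(t in I0) \esum_(n in A) ((h z n)%:E * (gauss t (z n d0))%:E))%E.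
  rewrite (integral_esum mu (measurable_itv _) A _ _).2; first last.
  - by move=> n t; rewrite mule_ge0// lee_fin// gauss_ge0.
  - move=> n; apply: emeasurable_funM; first exact: measurable_cst.
    exact: measurable_gauss.
  apply: eq_esum => n _.
  rewrite ge0_integralZl//; first last.
  - by rewrite lee_fin.
  - by move=> t _; rewrite lee_fin gauss_ge0.
  - exact: measurable_gauss.
  rewrite -muP -EFinM; congr (_%:E); rewrite (bigD1 d0)//= mulrC; congr (_ * _).
    apply: eq_bigr => d dd0; rewrite /mixed inE (negPf dd0)//.
  by rewrite /mixed inE eqxx.
have meas z : measurable_fun I0
    (fun t => \esum_(n in A) ((h z n)%:E * (gauss t (z n d0))%:E)%E).
  apply: (integral_esum mu (measurable_itv _) A _ _).1; last first.
  - by move=> n t; rewrite mule_ge0// lee_fin// gauss_ge0.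
  - move=> n; apply: emeasurable_funM; first exact: measurable_cst.
    exact: measurable_gauss.
have esum_h_ge0 z t : (0 <= \esum_(n in A) ((h z n)%:E * (gauss t (z n d0))%:E))%E.
  by apply: esum_ge0 => n _; rewrite mule_ge0// lee_fin// gauss_ge0.
rewrite !int_h; apply: ge0_le_integral.
- exact: measurable_itv.
- by move=> t _; exact: esum_h_ge0.
- exact: (meas x).
- exact: (meas y).
move=> t; rewrite /I0/= in_itv/= andbT => t0.
have := IH [eta lam with d0 |-> t] _.
have hE z n : ((h z n)%:E * (gauss t (z n d0))%:E)%E =
    (\prod_d mixed s [eta lam with d0 |-> t] d (z n d))%:E.
  rewrite -EFinM [in RHS](bigD1 d0)//= mulrC; congr (_ * _)%:E.
    by rewrite /mixed (negPf d0s)/= eqxx.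
  by apply: eq_bigr => d dd0; rewrite /mixed /= (negPf dd0).
under [in X in _ -> (X <= _)%E]eq_esum do rewrite hE.
under [in X in _ -> (_ <= X)%E]eq_esum do rewrite hE.
by apply => d /=; case: eqP.
Qed.

End GaussianMixture.

Lemma esumZl (R : realType) (T : choiceType) (A : set T) (c : R) (f : T -> R) :
  0 < c -> (forall x, 0 <= f x) ->
  (\esum_(x in A) (c * f x)%:E = c%:E * \esum_(x in A) (f x)%:E)%E.
Proof.
move=> c0 f0.
have le_c (a : R) (g : T -> R) : 0 < a -> (forall x, 0 <= g x) ->
    (\esum_(x in A) (a * g x)%:E <= a%:E * \esum_(x in A) (g x)%:E)%E.
  move=> a0 g0; apply: esum_sup_le => X finX XA.
  rewrite -mulr_fsumr EFinM lee_pmul2l// -fsumEFin//.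
  by apply: esum_ge; exists X.
apply/eqP; rewrite eq_le le_c//=.
have := le_c c^-1 (fun x => c * f x) _ _; rewrite invr_gt0 => /(_ c0).
move=> /(_ (fun x => mulr_ge0 (ltW c0) (f0 x))) H.
rewrite -(@lee_pmul2l _ c^-1%:E) ?lte_fin ?invr_gt0//.
apply: le_trans H; rewrite muleA -EFinM mulVf ?gt_eqF// mul1e.
by apply: le_esum => x _; rewrite mulrA mulVf ?gt_eqF// mul1r.
Qed.

(** * Lowering one side of a loop *)

Section ClassComparison.
Variables (R : realType) (U : int -> R) (F E : finType) (l r : E -> F) (f0 : F).
Hypothesis hU : annealed_gaussian U.
Hypothesis connected_lr : forall n : F -> int,
  (forall d, n (l d) = n (r d)) -> forall g, n g = n f0.
Variables (P : pred E) (D Up : pred F) (h : int) (b : {ffun F -> int}).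
Hypothesis D_f0 : D f0.
Hypothesis D_notP : forall d, ~~ P d -> D (l d) && D (r d).
Hypothesis b_up : forall g, D g -> Up g -> h <= b g.
Hypothesis b_dn : forall g, D g -> ~~ Up g -> b g <= h - 1.
Variable c : E -> int.
Hypothesis c_P : forall d, P d -> c d = (Up (l d))%:Z - (Up (r d))%:Z.
Hypothesis c_notP : forall d, ~~ P d -> c d = 0.

(** On [P] the current [c] is the gradient of the indicator of [Up], so subtracting it replaces [n]
    by [dn n], whose boundary values are [b']. Off [P] both sides carry the same constant [rho]. For
    fixed couplings this is [Zc_lower]. *)
Lemma class_le :
  (\esum_(n in [set n | agree D b n])
     (\prod_d expR (- U (n (l d) - n (r d))))%:E <=
   \esum_(n in [set n | agree D b n])
     (\prod_d expR (- U (n (l d) - n (r d) - c d)))%:E)%E.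
Proof.
pose gr (n : {ffun F -> int}) d := n (l d) - n (r d).
apply: (@gauss_mixture_le _ _ _ _ _ gr (fun n d => gr n d - c d) hU) => lam lam0.
pose rho : R := \prod_(d | ~~ P d) gauss (lam d) (b (l d) - b (r d)).
have rho0 : 0 < rho by apply: prodr_gt0 => d _; exact: expR_gt0.
pose b' : {ffun F -> int} := [ffun g => b g - (Up g)%:Z].
pose dn (n : {ffun F -> int}) : {ffun F -> int} := [ffun g => n g - (Up g)%:Z].
pose cw b n := cond_weight l r lam P D b n.
have cw0 b0 n : 0 <= cw b0 n by exact: cond_weight_ge0.
have split_rho n d : agree D b n -> ~~ P d -> gr n d = b (l d) - b (r d).
  by move=> /agreeP bn /D_notP/andP[Dl Dr]; rewrite /gr !bn.
have agree_dn n : agree D b' (dn n) = agree D b n.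
  by apply/agreeP/agreeP => H g Dg; have := H g Dg; rewrite !ffunE; lia.
have -> : (\esum_(n in [set n | agree D b n])
    (\prod_d gauss (lam d) (gr n d))%:E = rho%:E * \esum_(n in setT) (cw b n)%:E)%E.
  rewrite -esumZl// esum_mkcond; apply: eq_esum => n _.
  rewrite /cw /cond_weight; case: ifPn; rewrite ?(inE, notin_setE)/= => bn; last first.
    by rewrite (negPf (introN idP bn)) mulr0.
  rewrite bn [in LHS](bigID P)/= mulrC; congr (_ * _)%:E.
  by apply: eq_bigr => d dP; rewrite split_rho.
have -> : (\esum_(n in [set n | agree D b n])
    (\prod_d gauss (lam d) (gr n d - c d))%:E =
    rho%:E * \esum_(n in setT) (cw b' n)%:E)%E.
  rewrite [in RHS](@reindex_esum _ _ _ [set: {ffun F -> int}] _ dn); last first.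
    split=> // [n n' _ _ /ffunP nn'|n _].
      by apply/ffunP => g; have := nn' g; rewrite !ffunE => /addIr.
    by exists [ffun g => n g + (Up g)%:Z] => //; apply/ffunP => g; rewrite !ffunE addrK.
  rewrite -esumZl// esum_mkcond; apply: eq_esum => n _.
  rewrite /cw /cond_weight agree_dn.
  case: ifPn; rewrite ?(inE, notin_setE)/= => bn; last first.
    by rewrite (negPf (introN idP bn)) mulr0.
  rewrite bn [in LHS](bigID P)/= mulrC; congr (_ * _)%:E.
    by apply: eq_bigr => d dP; rewrite split_rho// c_notP// subr0.
  apply: eq_bigr => d dP; rewrite !ffunE c_P// /gr; congr gauss; lia.
rewrite lee_pmul2l//.
have s b0 := cond_weight_summable connected_lr lam0 D_f0 D_notP b0.
rewrite -[leLHS]fineK; last exact: esum_fin_num (cw0 _) (s b).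
rewrite -[leRHS]fineK; last exact: esum_fin_num (cw0 _) (s b').
rewrite lee_fin; exact: (Zc_lower connected_lr lam0 D_f0 D_notP b_up b_dn).
Qed.

End ClassComparison.

(** * Currents on a plane graph *)

(* [seq] has homonymous functions. *)
Local Notation rev := Defs.rev.
Local Notation rot := Defs.rot.
Local Notation rot_inj := Defs.rot_inj.

Section Edges.
Variable G : plane_graph.
Implicit Types (d : dart G) (v : vert G) (f : face G).

Definition edge : finType := {d : dart G | d \in froots (@rev G)}.

Lemma froot_rev d : froot (@rev G) (rev d) = froot (@rev G) d.
Proof.
apply/eqP; rewrite root_connect; last exact/fconnect_sym/inv_inj/rev_invol.
by rewrite (fconnect_sym (inv_inj (@rev_invol G))) fconnect1.
Qed.

Lemma mem_froot_rev d : froot (@rev G) d \in [:: d; rev d].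
Proof.
have /iter_findex <- : fconnect (@rev G) d (froot (@rev G) d) by exact: connect_root.
elim: findex => [|k IH] /=; first by rewrite inE eqxx.
by move: IH; rewrite !inE => /orP[/eqP ->|/eqP ->];
  rewrite ?rev_invol eqxx ?orbT.
Qed.

Lemma rev_in_froots d : (rev d \in froots (@rev G)) = (d \notin froots (@rev G)).
Proof.
rewrite !inE /roots /= froot_rev; have := mem_froot_rev d; rewrite !inE.
case: (eqVneq (froot (@rev G) d) d) => [->|_] /=; last by move=> ->.
by rewrite eq_sym (negPf (rev_neq d)).
Qed.

Lemma sum_darts (V : nmodType) (h : dart G -> V) :
  \sum_d h d = \sum_(d : edge) (h (val d) + h (rev (val d))).
Proof.
rewrite (bigID [in froots (@rev G)])/= big_split/=; congr (_ + _).
  by rewrite big_sub.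
rewrite -(big_sub [in froots (@rev G)] (fun d => h (rev d))).
rewrite (reindex_inj (inv_inj (@rev_invol G))) /=.
by apply: eq_bigl => d; rewrite rev_in_froots negbK.
Qed.

Lemma card_edge : #|edge| = (#|dart G|./2)%N.
Proof.
suff -> : #|dart G| = (#|edge| * 2)%N by rewrite muln2 doubleK.
have := sum_darts (fun=> 1%N); rewrite -[RHS]/(\sum_(d : edge) 2)%N.
have -> : (\sum_(d : edge) 2 = #|edge| * 2)%N by rewrite sum_nat_const.
by move=> <-; rewrite -sum1_card; apply: eq_bigl.
Qed.

Lemma source_rot d : source (rot d) = source d.
Proof. by apply/eqP; rewrite -sourceP (fconnect_sym (@rot_inj G)) fconnect1. Qed.

Lemma right_rot d : right (rot d) = left d.
Proof.
apply/eqP; rewrite /right -leftP.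
have := fconnect1 (finv (@rot G) \o @rev G) (rev (rot d)).
by rewrite /= rev_invol (finv_f (@rot_inj G)).
Qed.

Lemma edge_all (Q : dart G -> Prop) : (forall d, Q (rev d) -> Q d) ->
  (forall d : edge, Q (val d)) -> forall d, Q d.
Proof.
move=> Qrev Qe d; case: (boolP (d \in froots (@rev G))) => dr.
  exact: (Qe (exist _ d dr)).
by rewrite -rev_in_froots in dr; apply: Qrev; exact: (Qe (exist _ (rev d) dr)).
Qed.

Lemma vert_const (T : Type) (h : vert G -> T) :
  (forall d : edge, h (source (val d)) = h (target (val d))) ->
  forall u v, h u = h v.
Proof.
move=> hE.
have hD d : h (source d) = h (target d).
  apply: (@edge_all (fun d => h (source d) = h (target d))) => // d'.
  by rewrite /target rev_invol => ->.
move=> u v; have /connectP[p pth ->] := vert_connected u v.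
elim: p u pth => //= w p IH u /andP[/existsP[d /andP[/eqP <- /eqP <-]] /IH <-].
exact: hD.
Qed.

(** The dual graph is connected: the faces around a vertex follow each other across its darts, as
    [right (rot d) = left d], and the two faces of an edge are met at both its ends, so walking
    along edges reaches every face. *)
Lemma face_const (T : Type) (h : face G -> T) :
  (forall d : edge, h (left (val d)) = h (right (val d))) ->
  forall f g, h f = h g.
Proof.
move=> hE.
have hD d : h (left d) = h (right d).
  apply: (@edge_all (fun d => h (left d) = h (right d))) => // d'.
  by rewrite /right rev_invol => ->.
have hrot d : h (left (rot d)) = h (left d) by rewrite hD right_rot.
have hsource d d' : source d = source d' -> h (left d) = h (left d').
  move=> /eqP; rewrite -sourceP => /iter_findex <-.
  by elim: findex => //= k ->; rewrite hrot.
have hv u v : forall d d', source d = u -> source d' = v -> h (left d) = h (left d').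
  have /connectP[p pth ->] := vert_connected u v.
  elim: p u pth => [|w p IH] u /=.
    by move=> _ d d' <- ?; exact: hsource.
  move=> /andP[/existsP[d0 /andP[/eqP d0u /eqP d0w]] pth] d d' du d'v.
  rewrite -(IH _ pth (rev d0) d')// -[RHS]/(h (right d0)) -hD.
  by apply: hsource; rewrite du.
move=> f g; have [d <-] := left_surj f; have [d' <-] := left_surj g.
exact: hv.
Qed.

Definition edge_left (d : edge) : face G := left (val d).
Definition edge_right (d : edge) : face G := right (val d).
Definition hgrad := grad edge_left edge_right.

Definition divergence (m : {ffun edge -> int}) v : int :=
  \sum_(d : edge) m d * ((source (val d) == v)%:Z - (target (val d) == v)%:Z).

(** The outflow telescopes around the vertex, because [right (rot d) = left d]. *)
Lemma divergence_grad n v : divergence (hgrad n) v = 0.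
Proof.
transitivity (\sum_(d : dart G)
    (n (left d) - n (right d)) * (source d == v)%:Z).
  rewrite sum_darts; apply: eq_bigr => d _.
  by rewrite ffunE /edge_left /edge_right /right rev_invol -/(target _) /target; ring.
under eq_bigr do rewrite mulrBl.
rewrite sumrB [X in _ - X](reindex_inj (@rot_inj G)).
rewrite -[RHS](subrr (\sum_d n (left d) * (source d == v)%:Z)); congr (_ - _).
by apply: eq_bigr => d _; rewrite right_rot source_rot.
Qed.

End Edges.

(** * Sourceless currents are gradients *)

Section IncidenceRank.
Variables (F E : finType) (l r : E -> F).

Definition incidence : 'M[rat]_(#|F|, #|E|) :=
  \matrix_(i, j) ((l (enum_val j) == enum_val i)%:R - (r (enum_val j) == enum_val i)%:R).

Lemma incidenceE (phi : 'rV[rat]_#|F|) j :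
  (phi *m incidence) 0 j =
  phi 0 (enum_rank (l (enum_val j))) - phi 0 (enum_rank (r (enum_val j))).
Proof.
rewrite mxE; under eq_bigr do rewrite mxE mulrBr.
have pick f : \sum_i phi 0 i * (f == enum_val i)%:R = phi 0 (enum_rank f).
  rewrite (bigD1 (enum_rank f))//= enum_rankK eqxx mulr1 big1 ?addr0// => i i_f.
  case: eqP => [fE|_]; last by rewrite mulr0.
  by rewrite fE enum_valK eqxx in i_f.
by rewrite sumrB !pick.
Qed.

(** The left kernel consists of functions without jumps, hence of constants, and has dimension at
    most 1. *)
Lemma rank_incidence :
  (forall h : F -> rat, (forall d, h (l d) = h (r d)) -> forall f g, h f = h g) ->
  (#|F| <= (\rank incidence).+1)%N.
Proof.
move=> conn.
have : (kermx incidence <= (const_mx 1 : 'rV_#|F|))%MS.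
  apply/rV_subP => phi /sub_kermxP phi0.
  have [f0 _|F0] := pickP (@predT F); last first.
    by apply/sub_rVP; exists 0; apply/rowP => i; have := F0 (enum_val i).
  apply/sub_rVP; exists (phi 0 (enum_rank f0)); apply/rowP => i.
  rewrite !mxE mulr1 -(enum_valK i).
  apply: (conn (fun f => phi 0 (enum_rank f))) => d.
  have := congr1 (fun A : 'rV_ _ => A 0 (enum_rank d)) phi0.
  by rewrite incidenceE enum_rankK mxE => /eqP; rewrite subr_eq0 => /eqP.
move=> /mxrankS; rewrite mxrank_ker => /leq_trans/(_ (rank_leq_row _)).
by rewrite leq_subLR addn1.
Qed.

End IncidenceRank.

Section Exactness.
Variable G : plane_graph.

(* The cycle space has dimension #|edge| - #|vert| + 1, which by Euler's      *)
(* formula is that of the space of gradients of functions on the faces.       *)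
Lemma divergence_exact (m : {ffun edge G -> int}) :
  (forall v, divergence m v = 0) ->
  exists2 n, hgrad n = m & n (outer G) = 0.
Proof.
move=> div0.
pose C := incidence (@edge_left G) (@edge_right G).
pose B := incidence (fun d : edge G => source (val d)) (fun d => target (val d)).
have rC : (#|face G| <= (\rank C).+1)%N.
  by apply: rank_incidence => h hE; exact: face_const.
have rB : (#|vert G| <= (\rank B).+1)%N.
  by apply: rank_incidence => h hE; exact: vert_const.
(* Multiplication by [B^T] takes the divergence of a current. *)
have colB (mu : edge G -> int) v :
    ((\row_j (mu (enum_val j))%:~R) *m B^T) 0 (enum_rank v) =
    (divergence [ffun d => mu d] v)%:~R :> rat.
  rewrite mxE /divergence rmorph_sum /= (reindex (@enum_val _ (edge G))) /=; last first.
    by exists enum_rank => j _; rewrite ?enum_valK ?enum_rankK.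
  apply: eq_bigr => j _; rewrite !mxE ffunE enum_rankK rmorphM rmorphB/=.
  by rewrite -!pmulrn.
have CB : C *m B^T = 0.
  apply/row_matrixP => i; rewrite row_mul row0; apply/rowP => v.
  rewrite -(enum_valK v) !mxE.
  pose n : {ffun face G -> int} := [ffun f => (f == enum_val i)%:Z].
  have := colB (hgrad n) (enum_val v).
  have -> : [ffun d => hgrad n d] = hgrad n by apply/ffunP => d; rewrite ffunE.
  rewrite divergence_grad mxE => H; rewrite -[RHS]H; apply: eq_bigr => j _.
  by rewrite !mxE !ffunE rmorphB/= -!pmulrn.
have CK : (C <= kermx B^T)%MS by apply/sub_kermxP.
(* The kernel has dimension $|E|-\mathrm{rank}\,B\le|E|-|V|+1=|F|-1\le\mathrm{rank}\,C$. *)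
have rK : (\rank (kermx B^T) <= \rank C)%N.
  rewrite mxrank_ker mxrank_tr leq_subLR.
  move: (\rank C) (\rank B) rC rB (euler G) => rc rb; rewrite -card_edge; lia.
have KC : (kermx B^T <= C)%MS.
  by rewrite -(geq_leqif (mxrank_leqif_sup CK)).
pose mv : 'rV[rat]_#|edge G| := \row_j (m (enum_val j))%:~R.
have /submxP[phi mvE] : (mv <= C)%MS.
  apply: submx_trans KC; apply/sub_kermxP/rowP => v; rewrite -(enum_valK v).
  rewrite colB mxE; have -> : [ffun d => m d] = m by apply/ffunP => d; rewrite ffunE.
  by rewrite div0.
pose psi f := phi 0 (enum_rank f) - phi 0 (enum_rank (outer G)).
have psi_grad d : psi (edge_left d) - psi (edge_right d) = (m d)%:~R.
  have := congr1 (fun A : 'rV_ _ => A 0 (enum_rank d)) mvE.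
  rewrite /C incidenceE mxE !enum_rankK => ->; rewrite /psi; ring.
(* The rational potential vanishes at the outer face and has integer jumps, so it is integral
   everywhere and the floor taken below loses nothing. *)
have psi_int f : psi f \is a Num.int.
  rewrite (@face_const _ _ (fun f => psi f \is a Num.int) _ f (outer G)).
    by rewrite /psi subrr.
  move=> d; apply/idP/idP => pint.
    rewrite -[right _]/(edge_right d) -[psi _](subKr (psi (edge_left d))) psi_grad.
    by rewrite rpredB// intr_int.
  rewrite -[left _]/(edge_left d) -[psi _](subrK (psi (edge_right d))) psi_grad.
  by rewrite rpredD// intr_int.
exists [ffun f => Num.floor (psi f)]; last by rewrite ffunE /psi subrr floor0.
apply/ffunP => d; rewrite !ffunE; apply/eqP.
by rewrite -(eqr_int rat) rmorphB/= !floorK// psi_grad.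
Qed.

End Exactness.

(** [A] is the disjoint union of the classes [C n]. As [xget] depends only on the set [C n], [rep]
    chooses one point per class, and the inequality is summed over these. *)
Lemma esum_le_partition (R : realType) (T : choiceType) (A : set T)
    (C : T -> set T) (f g : T -> \bar R) :
  (forall n, 0 <= f n)%E -> (forall n, 0 <= g n)%E ->
  (forall n, A n -> C n n) -> (forall n, A n -> C n `<=` A) ->
  (forall n n', A n -> C n n' -> C n' = C n) ->
  (forall n, A n -> (\esum_(i in C n) f i <= \esum_(i in C n) g i)%E) ->
  (\esum_(n in A) f n <= \esum_(n in A) g n)%E.
Proof.
move=> f0 g0 Cn CA CC le_fg.
have [[n0 _]|/nonemptyPn ->] := pselect (A !=set0); last by rewrite !esum_set0.
pose rep n := xget n0 (C n).
have repC n : A n -> C n (rep n) by move=> An; apply: (xgetPex _ (ex_intro _ n (Cn _ An))).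
have CrepE n : A n -> C (rep n) = C n by move=> An; exact: CC (repC _ An).
have split_esum (k : T -> \bar R) : (forall n, 0 <= k n)%E ->
    (\esum_(n in A) k n = \esum_(i in rep @` A) \esum_(j in C i) k j)%E.
  move=> k0; rewrite esum_esum//; apply: reindex_esum; split.
  - move=> [i j] /= [[n An <-]]; rewrite CrepE// => Cj; exact: (CA _ An).
  - move=> [i j] [i' j'] /set_mem[/= [n An <-] Cj] /set_mem[/= [n' An' <-] Cj'] /= jj'.
    rewrite -jj' in Cj' *; congr (_, _); rewrite CrepE// in Cj; rewrite CrepE// in Cj'.
    by rewrite /rep -(CC _ _ An Cj) -(CC _ _ An' Cj').
  - move=> j Aj; exists (rep j, j) => //=; split; first by exists j.
    by rewrite CrepE//; exact: Cn.
rewrite !split_esum//; apply: le_esum => _ [n An <-].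
by rewrite CrepE//; exact: le_fg.
Qed.

(** * Level lines *)

Lemma head_filterE (T : eqType) (a : pred T) (x0 y : T) (s : seq T) :
  y \in s -> a y ->
  (head x0 [seq x <- s | a x] == y) = ~~ has a (take (index y s) s).
Proof.
elim: s => //= x s IH; rewrite inE; case: (eqVneq x y) => [-> _ ay|xy].
  by rewrite ay /= eqxx.
move=> /= ys ay; case: (boolP (a x)) => ax /=.
  by rewrite (negPf xy).
exact: IH.
Qed.

Section Contours.
Variable G : plane_graph.
Implicit Types (u v : vert G) (d : dart G) (p l : seq (dart G)) (f : face G).
Implicit Types (n : height G) (q : rat).

Lemma walk_cat u p1 p2 v : walk u (p1 ++ p2) v ->
  exists2 w, walk u p1 w & walk w p2 v.
Proof.
elim: p1 u => [|d p1 IH] u /=; first by exists u.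
by move=> /andP[-> /IH[w w1 w2]]; exists w.
Qed.

Lemma walk_sources u p v : walk u p v ->
  rcons (map (@source G) p) v = u :: map (@target G) p.
Proof. by elim: p u => [|d p IH] u /= => [/eqP -> //|/andP[/eqP <- /IH <-]]. Qed.

Lemma loop_sources_uniq u l : walk u l u -> uniq (map (@target G) l) ->
  uniq (map (@source G) l).
Proof.
move=> /walk_sources lE; rewrite (@perm_uniq _ _ (map (@target G) l))//.
by rewrite -(perm_cons u) -lE perm_sym perm_rcons.
Qed.

Lemma exterior_adjacent l d : d \notin l -> rev d \notin l ->
  exterior l (left d) = exterior l (right d).
Proof.
move=> dl rdl; rewrite /exterior; set adj := (fun g g' => _).
by apply/idP/idP => /connect_trans; apply; apply: connect1; apply/existsP;
  [exists d|exists (rev d)]; rewrite ?rev_invol dl rdl /right ?rev_invol !eqxx.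
Qed.

(* The darts which are examined when the level line turns from [d] to [d'].   *)
Definition scan d d' : seq (dart G) :=
  let s := orbit (@rot G) (rot (rev d)) in take (index d' s) s.

(** All darts examined while following the level line: the heights beside them decide whether it is
    one, so fixing these heights leaves the others free. *)
Fixpoint touched d p : seq (dart G) :=
  if p is d' :: p' then d :: scan d d' ++ touched d' p' else [:: d].

Lemma sub_touched d p : {subset d :: p <= touched d p}.
Proof.
elim: p d => [|d' p IH] d x /=; first by [].
by rewrite !inE mem_cat => /orP[->//|/IH ->]; rewrite !orbT.
Qed.

Lemma q_nextE n q d d' : source d' = target d -> q_edge n q d' ->
  (q_next n q d == d') = ~~ has (q_edge n q) (scan d d').
Proof.
move=> sd' qd'; apply: head_filterE => //.
by rewrite -fconnect_orbit sourceP source_rot sd'.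
Qed.

Lemma q_path_cons n q d d' p : source d' = target d ->
  q_path n q d (d' :: p) =
  [&& q_edge n q d, ~~ has (q_edge n q) (scan d d') & q_path n q d' p].
Proof.
move=> sd'; rewrite /q_path /=.
case: (boolP (q_edge n q d)) => //= _.
case: (boolP (q_edge n q d')) => [qd'|_]; last by rewrite andbF.
by rewrite q_nextE//= andbCA.
Qed.

Definition agree_on (s : seq (dart G)) n n' : Prop := forall d, d \in s ->
  val n (left d) = val n' (left d) /\ val n (right d) = val n' (right d).

Lemma q_edge_agree n n' q s : agree_on s n n' -> {in s, q_edge n q =1 q_edge n' q}.
Proof. by move=> nn' d /nn'[h1 h2]; rewrite /q_edge h1 h2. Qed.

Lemma q_path_agree n n' q d p v : walk (source d) (d :: p) v ->
  agree_on (touched d p) n n' -> q_path n q d p -> q_path n' q d p.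
Proof.
elim: p d => [|d' p IH] d.
  move=> _ nn'; rewrite /q_path /= !andbT.
  by rewrite (q_edge_agree q nn')// inE.
move=> /= /andP[_ wp] nn'; have /andP[/eqP sd' _] := wp; rewrite !q_path_cons//.
move=> /and3P[qd qs qp]; apply/and3P; split.
- by rewrite -(q_edge_agree q nn')//= inE eqxx.
- rewrite -(@eq_in_has _ (q_edge n q))// => x xs.
  by apply: (q_edge_agree q nn'); rewrite /= inE mem_cat xs orbT.
apply: IH qp; first by rewrite sd'.
by move=> x xp; apply: nn'; rewrite /= inE mem_cat xp !orbT.
Qed.

(** Both are initial segments of the iteration of [q_next] from [d], so one is a prefix of the
    other; distinct targets and a common end force equal lengths. *)
Lemma q_path_uniq n q d p1 p2 : q_path n q d p1 -> q_path n q d p2 ->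
  target (last d p1) = target (last d p2) ->
  uniq (map (@target G) (d :: p1)) -> uniq (map (@target G) (d :: p2)) ->
  p1 = p2.
Proof.
wlog le12 : p1 p2 / (size p1 <= size p2)%N.
  move=> H q1 q2 t12 u1 u2; have [le12|/ltnW le21] := leqP (size p1) (size p2).
    exact: H.
  by apply/esym/H.
move=> /andP[_ /fpathE p1E] /andP[_ /fpathE p2E] t12 _ u2.
suff sz : size p1 = size p2 by rewrite p1E p2E sz.
have take_p : p1 = take (size p1) p2.
  by rewrite p2E take_traject// {1}p1E.
have : nth (target d) (map (@target G) (d :: p2)) (size p1) =
       nth (target d) (map (@target G) (d :: p2)) (size p2).
  have last_nth p : last d p = nth d (d :: p) (size p).
    exact: esym (nth_last d (d :: p)).
  rewrite !(nth_map d)//= ?ltnS// -(last_nth p2) -t12 (last_nth p1).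
  by rewrite -[LHS]/(target _); congr target; rewrite [in RHS]take_p
    -[in RHS]/(take (size p1).+1 (d :: p2)) nth_take// size_takel.
by move=> /eqP; rewrite nth_uniq//= ?size_map ?ltnS// => /eqP.
Qed.

End Contours.

Lemma uniq_map_inj (T1 T2 : eqType) (f : T1 -> T2) (s : seq T1) :
  uniq (map f s) -> {in s &, injective f}.
Proof.
elim: s => //= a s IH /andP[fa us] x z; rewrite !inE.
move=> /orP[/eqP ->|xs] /orP[/eqP ->|zs] fE //.
- by rewrite fE map_f in fa.
- by rewrite -fE map_f in fa.
- exact: IH.
Qed.

Lemma half_lt (q : rat) (h z : int) : q = h%:~R - 2^-1 ->
  (q < z%:~R) = (h <= z) /\ (z%:~R < q) = (z <= h - 1).
Proof.
move=> ->; split; apply/idP/idP.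
- move=> H; suff : h - 1 < z by lia.
  by rewrite -(ltr_int rat) rmorphB/=; lra.
- move=> H; have : h%:~R <= z%:~R :> rat by rewrite ler_int.
  by lra.
- move=> H; suff : z < h by lia.
  by rewrite -(ltr_int rat); lra.
- move=> H; have : z%:~R <= (h - 1)%:~R :> rat by rewrite ler_int.
  by rewrite rmorphB/=; lra.
Qed.

Section Sides.
Variables (G : plane_graph) (l : seq (dart G)) (y : vert G).
Hypothesis simple_l : simple_loop y l.
Variable Up : pred (face G).
Hypothesis Up_left : forall d, d \in l -> Up (left d).
Hypothesis Up_right : forall d, d \in l -> ~~ Up (right d).
Hypothesis Up_adjacent : forall d, d \notin l -> rev d \notin l ->
  Up (left d) = Up (right d).
Variables (n : height G) (q : rat) (h : int).
Hypothesis q_h : q = h%:~R - 2^-1.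

Definition side f := if Up f then h <= val n f else val n f <= h - 1.

Let q_edgeE d : q_edge n q d = (val n (right d) <= h - 1) && (h <= val n (left d)).
Proof. by rewrite /q_edge (half_lt _ q_h).1 (half_lt _ q_h).2. Qed.

Let target_inj : {in l &, injective (@target G)}.
Proof. by have /and4P[_ _ ut _] := simple_l; exact: uniq_map_inj. Qed.

Let source_inj : {in l &, injective (@source G)}.
Proof.
have /and4P[_ wl ut _] := simple_l.
by apply: uniq_map_inj; exact: loop_sources_uniq wl ut.
Qed.

(** Rotating counterclockwise from [rev d] to [d'] starts in the low face [right d], outside [Up].
    No scanned dart lies on the loop in either direction, as a simple loop passes the vertex only
    once, so the faces stay outside [Up]; none is a q-edge, so the heights stay below $q$. Here the
    rule enters that a level line continues along the first outgoing q-edge met from its right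
    side. *)
Lemma scan_sides d d' : d \in l -> d' \in l -> source d' = target d ->
  q_edge n q d -> ~~ has (q_edge n q) (scan d d') ->
  forall x, x \in scan d d' -> side (left x) /\ side (right x).
Proof.
move=> dl d'l sd' qd /hasPn nq.
pose x0 := rot (rev d); pose k := order (@rot G) x0.
pose s := orbit (@rot G) x0.
have sE j : (j < k)%N -> nth x0 s j = iter j (@rot G) x0.
  by move=> jk; rewrite /s /orbit nth_traject.
have size_s : size s = k by rewrite /s size_orbit.
have lt_k : (index d' s < k)%N.
  by rewrite -size_s index_mem -fconnect_orbit sourceP source_rot sd'.
have scanE : scan d d' = take (index d' s) s by [].
have size_scan : size (scan d d') = index d' s by rewrite scanE size_takel// size_s ltnW.
have nth_scan j : (j < index d' s)%N -> nth x0 (scan d d') j = iter j (@rot G) x0.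
  by move=> ji; rewrite scanE nth_take// sE// (ltn_trans ji).
have step j (x := iter j (@rot G) x0) : (j < index d' s)%N ->
    ~~ Up (right x) -> val n (right x) <= h - 1 ->
    ~~ Up (left x) /\ val n (left x) <= h - 1.
  move=> ji ux nx.
  have xs : x \in scan d d' by rewrite /x -nth_scan// mem_nth// size_scan.
  have sx : source x = target d.
    by rewrite /x; elim: (j) => [|j' IH] /=; rewrite source_rot.
  have xl : x \notin l.
    apply/negP => xl; have := @before_find _ x0 (pred1 d') s j ji.
    rewrite sE ?(ltn_trans ji)// -/x /= => /eqP; apply.
    by apply: source_inj => //; rewrite sx.
  (* Otherwise [x] is [rev d], which closes the orbit of [x0] and so cannot precede [d']. *)
  have rxl : rev x \notin l.
    apply/negP => rxl; have dx : rev d = x.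
      by rewrite (target_inj dl rxl) ?rev_invol// /target rev_invol sx.
    have jk : (j.+1 < k)%N by exact: leq_ltn_trans ji lt_k.
    have : nth x0 s j.+1 = nth x0 s 0.
      by rewrite !sE ?(leq_ltn_trans _ jk)//= -/x -dx.
    by move=> /eqP; rewrite nth_uniq ?size_s ?orbit_uniq ?(leq_ltn_trans _ jk).
  rewrite Up_adjacent//; split=> //; have := nq _ xs; rewrite q_edgeE nx /=; lia.
have low j : (j < index d' s)%N ->
    [/\ ~~ Up (right (iter j (@rot G) x0)), val n (right (iter j (@rot G) x0)) <= h - 1,
        ~~ Up (left (iter j (@rot G) x0)) & val n (left (iter j (@rot G) x0)) <= h - 1].
  elim: j => [|j IH] ji.
    have u0 : ~~ Up (right x0) by rewrite right_rot; exact: Up_right.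
    have n0 : val n (right x0) <= h - 1.
      by move: qd; rewrite q_edgeE right_rot => /andP[].
    by have [] := step 0%N ji u0 n0.
  have [_ _ ul nl] := IH (ltnW ji).
  have ur : ~~ Up (right (iter j.+1 (@rot G) x0)) by rewrite /= right_rot.
  have nr : val n (right (iter j.+1 (@rot G) x0)) <= h - 1 by rewrite /= right_rot.
  by have [] := step _ ji ur nr.
move=> x /(nthP x0)[j]; rewrite size_scan => ji; rewrite nth_scan// => <-.
have [u1 n1 u2 n2] := low j ji.
by rewrite /side (negPf u1) (negPf u2).
Qed.

Lemma touched_sides d p v : {subset d :: p <= l} -> walk (source d) (d :: p) v ->
  q_path n q d p ->
  forall x, x \in touched d p -> side (left x) /\ side (right x).
Proof.
have dart_side x : x \in l -> q_edge n q x -> side (left x) /\ side (right x).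
  move=> xl; rewrite q_edgeE => /andP[nr nl].
  by rewrite /side (Up_left xl) (negPf (Up_right xl)).
elim: p d => [|d' p IH] d dpl.
  rewrite /q_path /= !andbT => _ qd x; rewrite inE => /eqP ->.
  by apply: dart_side => //; apply: dpl; rewrite mem_head.
move=> /= /andP[_ wp]; have /andP[/eqP sd' _] := wp; rewrite q_path_cons//.
move=> /and3P[qd qs qp] x; rewrite inE mem_cat => /or3P[/eqP ->||].
- by apply: dart_side => //; apply: dpl; rewrite mem_head.
- by apply: (scan_sides _ _ sd' qd qs); apply: dpl; rewrite !inE eqxx ?orbT.
- apply: (IH d') => //; last by rewrite sd'.
  by move=> z zp; apply: dpl; rewrite inE zp orbT.
Qed.

End Sides.

(** * The weight of the level-line event *)

Section LevelSum.
Variables (R : realType) (G : plane_graph) (U : int -> R).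
Hypothesis hU : annealed_gaussian U.
Variables (gamma : seq (dart G)) (e : dart G) (y : vert G).

(** The unit current along [gamma], signed by the orientation chosen for each edge. *)
Definition cut : {ffun edge G -> int} :=
  [ffun d => (val d \in gamma)%:Z - (rev (val d) \in gamma)%:Z].

Definition current_weight (m : {ffun edge G -> int}) : R :=
  \prod_d expR (- U (m d)).

Lemma current_weight_ge0 m : 0 <= current_weight m.
Proof. by apply: prodr_ge0 => d _; exact: expR_ge0. Qed.

Lemma height_weightE (n : height G) :
  height_weight U n = current_weight (hgrad (val n)).
Proof.
by rewrite /height_weight big_sub; apply: eq_bigr => d _; rewrite ffunE.
Qed.

Definition level_path (n : height G) q (p : seq (dart G)) : Prop :=
  [/\ q_path n q e p, target (last e p) = y,
      simple_loop y (gamma ++ e :: p) &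
      loop_orientation (gamma ++ e :: p) = sgz q].

Lemma level_path_uniq n q p1 p2 : level_path n q p1 -> level_path n q p2 ->
  p1 = p2.
Proof.
move=> [q1 t1 /and4P[_ _ u1 _] _] [q2 t2 /and4P[_ _ u2 _] _].
apply: (q_path_uniq q1 q2); first by rewrite t1.
  by move: u1; rewrite map_cat cat_uniq => /and3P[].
by move: u2; rewrite map_cat cat_uniq => /and3P[].
Qed.

(** The outer face is included since its height is always 0; this pins the functions of a class. *)
Definition seen p : pred (face G) := fun f =>
  (f == outer G) || has (fun d => (left d == f) || (right d == f)) (touched e p).

Lemma seen_touched p d : d \in touched e p -> seen p (left d) && seen p (right d).
Proof.
move=> dp; apply/andP; split; apply/orP; right; apply/hasP; exists d => //;
  by rewrite eqxx ?orbT.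
Qed.

Lemma level_path_agree n n' q p : agree (seen p) (val n) (val n') ->
  level_path n q p -> level_path n' q p.
Proof.
move=> /agreeP nn' [qp tp lp op]; split=> //.
have /and4P[_ /walk_cat[w _ wp] _ _] := lp.
apply: q_path_agree qp; first by move: wp => /= /andP[_]; rewrite eqxx; exact.
by move=> d /seen_touched /andP[dl dr]; rewrite !nn'.
Qed.

(** [Up] is the side of the loop to the left of its darts: the interior for $q>0$, the exterior for
    $q<0$. Away from the level line the jumps of its indicator are those of [cut], and
    [touched_sides] gives the bounds on the explored heights which [class_le] requires. *)
Lemma loop_class_le n q p : half_integer q -> level_path n q p ->
  (\esum_(m in [set m | agree (seen p) (val n) m]) (current_weight (hgrad m))%:E <=
   \esum_(m in [set m | agree (seen p) (val n) m])
     (current_weight [ffun d => hgrad m d - cut d])%:E)%E.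
Proof.
move=> [k qk] [qp tp lp op]; set l := gamma ++ e :: p in lp op *.
pose h := k + 1.
have q_h : q = h%:~R - 2^-1 by rewrite qk rmorphD/=; lra.
pose Up : pred (face G) := fun f => if 0 < q then ~~ exterior l f else exterior l f.
have q_pos : (0 < q) = (0 <= h - 1) := (half_lt 0 q_h).2.
have q_neg : (q < 0) = (h <= 0) := (half_lt 0 q_h).1.
have Up_lr d : d \in l -> Up (left d) /\ ~~ Up (right d).
  move=> dl; rewrite /Up; move: op; rewrite /loop_orientation.
  case: (boolP (0 < q)) => q0.
    rewrite gtr0_sgz//; case: ifP => [/allP/(_ _ dl)/andP[-> ->]//|_].
    by case: ifP.
  have q_lt0 : q < 0 by rewrite q_neg; rewrite q_pos in q0; lia.
  rewrite ltr0_sgz//; case: ifP => // _.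
  by case: ifP => [/allP/(_ _ dl)/andP[]|].
have Up_adj d : d \notin l -> rev d \notin l -> Up (left d) = Up (right d).
  by move=> dl rdl; rewrite /Up (exterior_adjacent dl rdl).
(* The outer height 0 must be on the side of $q$ predicted by [Up]; this is why the orientation of
   the loop is the sign of $q$. *)
have Up_outer : if Up (outer G) then h <= 0 else 0 <= h - 1.
  rewrite /Up /exterior connect0 q_pos; case: (boolP (0 <= h - 1)) => /=; lia.
have /and4P[_ wl ul rl] := lp.
have sides : forall x, x \in touched e p -> side Up n h (left x) /\ side Up n h (right x).
  have [w _ wp] := walk_cat wl.
  apply: (touched_sides lp _ _ Up_adj q_h _ _ qp (v := y)).
  - by move=> d /Up_lr[].
  - by move=> d /Up_lr[].
  - by move=> d dp; rewrite /l mem_cat dp orbT.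
  - by move: wp => /= /andP[_]; rewrite eqxx; exact.
have sideD f : seen p f -> side Up n h f.
  case/orP => [/eqP ->|/hasP[d /sides[sl sr] /orP[/eqP <-|/eqP <-]]//].
  by rewrite /side (eqP (valP n)).
(* The edges of the level line are excluded: the indicator of [Up] jumps across them while [cut]
   vanishes there. Both their faces are explored. *)
pose P : pred (edge G) := fun d => (val d \notin e :: p) && (rev (val d) \notin e :: p).
have lE d : d \in l = (d \in gamma) || (d \in e :: p) by rewrite mem_cat.
have ldisj d : d \in e :: p -> d \notin gamma.
  have : uniq l by exact: map_uniq ul.
  by rewrite /l cat_uniq => /and3P[_ /hasPn H _] /H.
have lrev d : d \in l -> rev d \notin l by move=> dl; exact: (allP rl).
have c_P d : P d -> cut d = (Up (edge_left d))%:Z - (Up (edge_right d))%:Z.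
  move=> /andP[dp rdp]; rewrite ffunE /edge_left /edge_right.
  have dlE : val d \in l = (val d \in gamma) by rewrite lE (negPf dp) orbF.
  have rdlE : rev (val d) \in l = (rev (val d) \in gamma) by rewrite lE (negPf rdp) orbF.
  case: (boolP (val d \in gamma)) => dg.
    have dl : val d \in l by rewrite dlE.
    have [-> /negPf ->] := Up_lr _ dl.
    by rewrite -rdlE (negPf (lrev _ dl)).
  case: (boolP (rev (val d) \in gamma)) => rdg.
    have rdl : rev (val d) \in l by rewrite rdlE.
    have [] := Up_lr _ rdl; rewrite /right rev_invol => -> /negPf ->.
    by [].
  by rewrite (Up_adj (val d)) ?dlE ?rdlE// !subrr.
have D_notP d : ~~ P d -> seen p (edge_left d) && seen p (edge_right d).
  rewrite negb_and !negbK => /orP[|] /sub_touched/seen_touched//.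
  by rewrite /right rev_invol andbC.
have c_notP d : ~~ P d -> cut d = 0.
  rewrite negb_and !negbK ffunE => /orP[|] dp; rewrite (negPf (ldisj _ dp)).
    have := lrev (val d); rewrite !lE dp orbT negb_or => /(_ isT)/andP[/negPf -> _].
    by rewrite subrr.
  have := lrev (rev (val d)); rewrite rev_invol !lE dp orbT negb_or.
  by move=> /(_ isT)/andP[/negPf -> _]; rewrite subrr.
have conn (h' : face G -> int) : (forall d : edge G, h' (edge_left d) = h' (edge_right d)) ->
    forall g, h' g = h' (outer G).
  by move=> hE g; exact: face_const.
have b_up f : seen p f -> Up f -> h <= val n f by move=> /sideD; rewrite /side => + uf; rewrite uf.
have b_dn f : seen p f -> ~~ Up f -> val n f <= h - 1.
  by move=> /sideD; rewrite /side => + /negPf uf; rewrite uf.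
have seen_outer : seen p (outer G) by rewrite /seen eqxx.
have := class_le hU conn seen_outer D_notP b_up b_dn c_P c_notP.
congr (_ <= _)%E; apply: eq_esum => m _; congr (_%:E);
  by apply: eq_bigr => d _; rewrite !ffunE.
Qed.

(** A class consists of the height functions with given values on the faces seen by the path. The
    path is constant on it, and so is [qt], because both faces of [e] are seen. Hence the event is a
    disjoint union of classes, and [loop_class_le] applies to each. *)
Lemma level_sum_le (qt : height G -> rat) :
  (forall n, half_integer (qt n)) ->
  (forall n n' : height G,
     [set val n (left e); val n (right e)] =
     [set val n' (left e); val n' (right e)] -> qt n = qt n') ->
  (\esum_(n in [set n | level_event gamma e y (qt n) n]) (height_weight U n)%:E <=
   \esum_(n in [set n | level_event gamma e y (qt n) n])
     (current_weight [ffun d => hgrad (val n) d - cut d])%:E)%E.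
Proof.
move=> qt_half qt_pair.
pose path_of n := xget [::] (level_path n (qt n)).
pose A := [set n | level_event gamma e y (qt n) n].
have pathP n : A n -> level_path n (qt n) (path_of n).
  by move=> [p np]; exact: (xgetPex _ (ex_intro _ p np)).
pose C n := [set n' : height G | agree (seen (path_of n)) (val n) (val n')].
have CP n n' : A n -> C n n' -> level_path n' (qt n') (path_of n).
  move=> An nn'; have := level_path_agree nn' (pathP _ An).
  suff -> : qt n' = qt n by [].
  have [seel seer] : seen (path_of n) (left e) /\ seen (path_of n) (right e).
    by apply/andP/seen_touched/sub_touched; rewrite mem_head.
  by apply: qt_pair; rewrite !(agreeP _ _ _ nn').
have CA n : A n -> C n `<=` A.
  by move=> An n' /(CP _ _ An) np; exists (path_of n).
have C_path n n' : A n -> C n n' -> path_of n' = path_of n.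
  move=> An nn'; have An' := CA _ An _ nn'.
  exact: level_path_uniq (pathP _ An') (CP _ _ An nn').
apply: (@esum_le_partition _ _ A C).
- by move=> n; rewrite lee_fin height_weightE current_weight_ge0.
- by move=> n; rewrite lee_fin current_weight_ge0.
- by move=> n _; apply/agreeP.
- exact: CA.
- move=> n n' An nn'; rewrite /C (C_path _ _ An nn').
  apply/seteqP; split=> m /agreeP H; apply/agreeP => g gD; rewrite H//;
    by rewrite (agreeP _ _ _ nn').
move=> n An.
have valC : val @` C n = [set m | agree (seen (path_of n)) (val n) m].
  apply/seteqP; split=> [_ [n' nn' <-]//|m nm].
  have m0 : m (outer G) == 0.
    by rewrite (agreeP _ _ _ nm) ?(eqP (valP n))// /seen eqxx.
  by exists (exist _ m m0).
have toval (f : {ffun face G -> int} -> R) :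
    \esum_(i in C n) (f (val i))%:E =
    \esum_(m in [set m | agree (seen (path_of n)) (val n) m]) (f m)%:E.
  by rewrite -valC esum_image// => i j _ _; exact: val_inj.
under eq_esum do rewrite height_weightE.
rewrite (toval (fun m => current_weight (hgrad m))).
rewrite (toval (fun m => current_weight [ffun d => hgrad m d - cut d])).
exact: loop_class_le (qt_half n) (pathP _ An).
Qed.

End LevelSum.

(** * Duality with the spin model *)

Section CosineIntegrals.
Variable R : realType.
Local Notation period := (`[(- pi)%R, pi%R[%classic : set R).
Local Notation mu := (@lebesgue_measure R).

Lemma sin_period (a : R) (k : int) : sin (a + k%:~R * (pi *+ 2)) = sin a.
Proof.
have sinn (b : R) (j : nat) : sin (b + j%:R * (pi *+ 2)) = sin b.
  by rewrite mulr_natl (periodicn (@sinD2pi R)).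
case: k => j; first exact: sinn.
by rewrite NegzE -[RHS](sinn _ j.+1) mulrNz mulNr -[in LHS](sinn _ j.+1) subrK.
Qed.

Lemma continuous_period_integrable (f : R -> R) : continuous f ->
  mu.-integrable period (EFin \o f).
Proof.
move=> cf; apply: (@integrableS _ _ _ mu `[(- pi)%R, pi%R]%classic).
- exact: measurable_itv.
- exact: measurable_itv.
- by apply: subset_itvl; rewrite bnd_simp.
apply: continuous_compact_integrable; first exact: segment_compact.
exact: continuous_subspaceT.
Qed.

Lemma continuous_cos_phase (a b : R) : continuous (fun t => cos (a * t + b)).
Proof.
move=> t; apply: (@continuous_comp _ _ _ (fun t => a * t + b) (@cos R));
  last exact: continuous_cos.
apply: cvgD; last exact: cvg_cst.
by apply: cvgM; [exact: cvg_cst|exact: cvg_id].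
Qed.

Lemma period_measure : mu period = (pi *+ 2)%:E.
Proof.
rewrite lebesgue_measure_itv/= lte_fin ifT; last first.
  by rewrite (@lt_trans _ _ 0)// ?oppr_lt0 pi_gt0.
by rewrite -EFinD opprK mulr2n.
Qed.

Lemma Rintegral_cos_phase (k : int) (b : R) :
  \int[mu]_(t in period) cos (k%:~R * t + b) =
  if k == 0 then pi *+ 2 * cos b else 0.
Proof.
have [->|k0] := eqVneq k 0.
  under eq_Rintegral do rewrite mul0r add0r.
  by rewrite Rintegral_cst//= period_measure mulrC.
have kR : k%:~R != 0 :> R by rewrite intr_eq0.
rewrite Rintegral_itv_bndo_bndc; last first.
  exact: (continuous_period_integrable (@continuous_cos_phase k%:~R b)).
pose F (t : R) := (k%:~R)^-1 * sin (k%:~R * t + b) : R.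
have dF (t : R) : is_derive t 1 F (cos (k%:~R * t + b)).
  have dg : is_derive t 1 (fun t : R => k%:~R * t + b) (k%:~R : R).
    have d1 : is_derive t (1 : R) (k%:~R \*: (id : R -> R)) (k%:~R *: (1 : R)).
      exact: is_deriveZ.
    have d2 : is_derive t (1 : R) (cst b : R -> R) 0 by exact: is_derive_cst.
    have d3 := is_deriveD d1 d2.
    have e : k%:~R = k%:~R *: (1 : R) + 0 by rewrite addr0 /GRing.scale/= mulr1.
    by rewrite [X in is_derive _ _ _ X]e; exact: d3.
  have d4 := is_deriveZ (k%:~R)^-1 (@is_derive1_comp _ (@sin R)
    (fun t : R => k%:~R * t + b) t _ _ (is_derive_sin (k%:~R * t + b)) dg).
  have e : cos (k%:~R * t + b) = (k%:~R)^-1 *: (cos (k%:~R * t + b) * k%:~R).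
    by rewrite /GRing.scale/=; field.
  by rewrite [X in is_derive _ _ _ X]e; exact: d4.
have cF : continuous F.
  by move=> t; apply: differentiable_continuous; apply/derivable1_diffP; have [] := dF t.
rewrite /Rintegral (@continuous_FTC2 _ _ F).
- rewrite -EFinB /= /F -mulrBr.
  have -> : k%:~R * pi + b = (k%:~R * - pi + b) + k%:~R * (pi *+ 2).
    rewrite mulr2n; ring.
  by rewrite sin_period subrr mulr0.
- by rewrite (@lt_trans _ _ 0)// ?oppr_lt0 pi_gt0.
- exact: (continuous_subspaceT (@continuous_cos_phase k%:~R b)).
- split.
  + by move=> t _; have [] := dF t.
  + exact/cvg_at_right_filter/cF.
  + exact/cvg_at_left_filter/cF.
- by move=> t _; rewrite derive1E; exact: derive_val.
Qed.

Variable V : finType.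

Definition angle (k : V -> int) (theta : V -> R) : R :=
  \sum_v (k v)%:~R * theta v.

Definition cos_sum (J : finType) (c : J -> R) (k : J -> V -> int)
  (theta : V -> R) : R := \sum_j c j * cos (angle (k j) theta).

Lemma angle_update k theta v t :
  angle k [eta theta with v |-> t] =
  (k v)%:~R * t + \sum_(u | u != v) (k u)%:~R * theta u.
Proof.
rewrite /angle (bigD1 v)//= eqxx; congr (_ + _).
by apply: eq_bigr => u /negPf /= ->.
Qed.

Lemma continuous_cos_angle (k : V -> int) theta v :
  continuous (fun t => cos (angle k [eta theta with v |-> t])).
Proof.
rewrite (_ : (fun t => _) = (fun t => cos ((k v)%:~R * t +
  \sum_(u | u != v) (k u)%:~R * theta u))); first exact: continuous_cos_phase.
by apply/funext => t; rewrite angle_update.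
Qed.

Lemma cos_sum_continuous (J : finType) (c : J -> R) k theta v :
  continuous (fun t => cos_sum c k [eta theta with v |-> t]).
Proof.
move=> t; rewrite /cos_sum; apply: cvg_big => [|j _]; first exact: add_continuous.
apply: cvgM; [exact: cvg_cst|exact: continuous_cos_angle].
Qed.

Lemma Rintegral_cos_sum (J : finType) (c : J -> R) k theta v :
  \int[mu]_(t in period) cos_sum c k [eta theta with v |-> t] =
  cos_sum (fun j => if k j v == 0 then pi *+ 2 * c j else 0) k theta.
Proof.
rewrite /cos_sum.
pose S (s : seq J) t := \sum_(j <- s) c j * cos (angle (k j) [eta theta with v |-> t]).
have H (s : seq J) : mu.-integrable period (EFin \o S s) /\
    \int[mu]_(t in period) S s t =
    \sum_(j <- s) (if k j v == 0 then pi *+ 2 * c j else 0) * cos (angle (k j) theta).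
  elim: s => [|j s [IHi IH]].
    have -> : S [::] = cst 0 by apply/funext => t; rewrite /S big_nil.
    split; first by apply: continuous_period_integrable => t; exact: cvg_cst.
    by rewrite big_nil Rintegral_cst// mul0r.
  pose a t := cos (angle (k j) [eta theta with v |-> t]).
  have -> : S (j :: s) = (fun t => c j * a t + S s t).
    by apply/funext => t; rewrite /S big_cons.
  have ca : continuous a := @continuous_cos_angle (k j) theta v.
  have ia := continuous_period_integrable ca.
  have ica : mu.-integrable period (EFin \o (fun t => c j * a t)).
    apply: continuous_period_integrable => t.
    by apply: cvgM; [exact: cvg_cst|exact: ca].
  split.
    rewrite (_ : EFin \o _ = (EFin \o (fun t => (c j * a t)%R)) \+ (EFin \o S s))%E.
      exact: integrableD.
    by apply/funext => t /=; rewrite EFinD.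
  rewrite RintegralD//= IH big_cons; congr (_ + _).
  rewrite RintegralZl// /a; under eq_Rintegral do rewrite angle_update.
  rewrite Rintegral_cos_phase; case: eqP => kv; last by rewrite mul0r mulr0.
  rewrite mulrCA mulrA; congr (_ * cos _).
  by rewrite /angle [RHS](bigD1 v)//= kv mul0r add0r.
exact: (H _).2.
Qed.

Lemma spin_integral_cos_sum (J : finType) (c : J -> R) k (s : seq V) theta :
  spin_integral s (cos_sum c k) theta =
  cos_sum (fun j => if all (fun v => k j v == 0) s
                    then (pi *+ 2) ^+ size s * c j else 0) k theta.
Proof.
elim: s theta => [|v s IH] theta /=.
  by apply: eq_bigr => j _; rewrite expr0 mul1r.
under eq_Rintegral do rewrite IH.
rewrite Rintegral_cos_sum; apply: eq_bigr => j _.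
case: (k j v == 0) => //=; case: ifP; rewrite ?mulr0// => _.
by rewrite exprS mulrA.
Qed.

Lemma cos_sum_le (J : finType) (c : J -> R) k theta : (forall j, 0 <= c j) ->
  `|cos_sum c k theta| <= \sum_j c j.
Proof.
move=> c0; apply: (le_trans (ler_norm_sum _ _ _)); apply: ler_sum => j _.
rewrite normrM (ger0_norm (c0 j)) ler_piMr//.
by rewrite ler_norml cos_geN1 cos_le1.
Qed.

(** Dominated convergence in one coordinate at a time: [spin_integral_cos_sum] evaluates the inner
    integrals, which are thus continuous and bounded by $(2\pi)^{|s|}M$. *)
Lemma spin_integral_cvg (J : nat -> finType) (c : forall N, J N -> R)
    (k : forall N, J N -> V -> int) (F : (V -> R) -> R) (M : R) :
  (forall N j, 0 <= c N j) -> (forall N, \sum_j c N j <= M) ->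
  (forall theta, cos_sum (@c N) (@k N) theta @[N --> \oo] --> F theta) ->
  forall (s : seq V) theta,
    spin_integral s (cos_sum (@c N) (@k N)) theta @[N --> \oo] -->
    spin_integral s F theta.
Proof.
move=> c0 cM cF; elim=> [|v s IH] theta /=; first exact: cF.
pose g N t := spin_integral s (cos_sum (@c N) (@k N)) [eta theta with v |-> t].
pose g0 t := spin_integral s F [eta theta with v |-> t].
have gcont N : continuous (g N).
  rewrite /g; under eq_fun do rewrite spin_integral_cos_sum.
  exact: cos_sum_continuous.
have mg N : measurable_fun period (EFin \o g N).
  apply/measurable_EFinP; apply: measurable_funTS.
  by apply: continuous_measurable_fun; exact: gcont.
have cg t : (EFin \o g N) t @[N --> \oo] --> (EFin \o g0) t.
  by apply: cvg_EFin; [exact: nearW|exact: IH].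
have mg0 : measurable_fun period (EFin \o g0).
  by apply: (@emeasurable_fun_cvg _ _ R _ (fun N => EFin \o g N)) => // t _; exact: cg.
pose B : R := (pi *+ 2) ^+ size s * M.
have gB N t : `|g N t| <= B.
  rewrite /g spin_integral_cos_sum; apply: (le_trans (cos_sum_le _ _ _)).
    move=> j; case: ifP => // _; rewrite mulr_ge0// exprn_ge0// mulrn_wge0//.
    exact: pi_ge0.
  apply: (@le_trans _ _ (\sum_j (pi *+ 2) ^+ size s * c N j)).
    apply: ler_sum => j _; case: ifP => // _.
    by rewrite mulr_ge0// exprn_ge0// mulrn_wge0// pi_ge0.
  by rewrite -mulr_sumr ler_wpM2l// exprn_ge0// mulrn_wge0// pi_ge0.
have iB : mu.-integrable period (EFin \o cst B).
  by apply: continuous_period_integrable => t; exact: cvg_cst.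
have [||ig0 _ cvg_int] := @dominated_convergence _ _ _ mu period
  (measurable_itv _) (fun N => EFin \o g N) (EFin \o g0) (EFin \o cst B)
  mg mg0 _ iB _.
- by apply: aeW => t _; exact: cg.
- by apply: aeW => t N _ /=; rewrite lee_fin.
have ifin : (\int[mu]_(t in period) (g0 t)%:E)%E \is a fin_num.
  exact: integrable_fin_num.
rewrite /Rintegral; by apply: fine_cvg; rewrite fineK//; exact: cvg_int.
Qed.

End CosineIntegrals.

Section SpinSeries.
Variables (R : realType) (U : int -> R).
Hypothesis hU : annealed_gaussian U.
Hypothesis hsum : (\esum_(m in [set: int]) (expR (- U m))%:E < +oo)%E.

Definition total_weight : R := fine (\esum_(m in [set: int]) (expR (- U m))%:E)%E.

Lemma symsum_expR_le N : symsum (fun m => expR (- U m)) N <= total_weight.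
Proof.
rewrite -lee_fin /total_weight fineK; last by apply: esum_fin_num => // m; exact: expR_ge0.
by apply: symsum_le_esum => m; exact: expR_ge0.
Qed.

Definition partial_G N (phi : R) : R :=
  symsum (fun m => expR (- U m) * cos (m%:~R * phi)) N.

(** The [limn] in [sumZ] is meaningful only once convergence is known. Grouping $m$ with $-m$ makes
    the symmetric sums a series, dominated by that of the weights. *)
Lemma partial_G_cvg phi : partial_G N phi @[N --> \oo] --> complex.Re (spin_G U phi).
Proof.
pose f (m : int) := expR (- U m) * cos (m%:~R * phi).
have -> : complex.Re (spin_G U phi) = limn (symsum f).
  rewrite /= /sumZ; congr (limn _); apply/funext => N; apply: eq_bigr => k _.
  rewrite /f /= !(mul0r, mul1r, mulr0, mulr1, addr0, add0r, subr0, oppr0, mulNr, mulrN, opprK).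
  by rewrite cosN.
suff : cvgn (symsum f) by [].
pose w m := expR (- U m).
pose u j := f j.+1%:Z + f (- j.+1%:Z).
pose v j := w j.+1%:Z + w (- j.+1%:Z).
have sE g N : symsum g N = g 0 + series (fun j => g j.+1%:Z + g (- j.+1%:Z)) N.
  elim: N => [|N IH]; first by rewrite symsum0 /series/= big_geq// addr0.
  by rewrite symsumS IH -addrA /series/= big_nat_recr.
have -> : symsum f = (fun N => f 0 + series u N) by apply/funext => N; exact: sE.
apply: is_cvgD; first exact: is_cvg_cst.
apply: normed_cvg.
have v0 j : 0 <= v j by rewrite addr_ge0// expR_ge0.
have f_le m : `|f m| <= w m.
  rewrite normrM ger0_norm ?expR_ge0// ler_piMr ?expR_ge0//.
  by rewrite ler_norml cos_geN1 cos_le1.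
apply: (@series_le_cvg _ _ v) => [j|//|j|] /=; first exact: normr_ge0.
  by rewrite /u (le_trans (ler_normD _ _))// lerD.
apply: nondecreasing_is_cvgn.
  by apply/nondecreasing_seqP => N; rewrite /series/= big_nat_recr//= lerDl.
exists total_weight => _ [N _ <-].
apply: le_trans (symsum_expR_le N); rewrite sE lerDr; exact: expR_ge0.
Qed.

Definition expi (t : R) : R[i] := (cos t +i* sin t)%C.

Lemma expiD s t : expi (s + t) = expi s * expi t.
Proof. by rewrite /expi cosD sinD [sin s * _ + _]addrC; simpc. Qed.

Lemma expi0 : expi 0 = 1.
Proof. by rewrite /expi cos0 sin0. Qed.

Lemma expi_sum (I : finType) (a : I -> R) :
  expi (\sum_i a i) = \prod_i expi (a i).
Proof. by apply: (big_morph expi expiD expi0). Qed.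

Lemma sum_complex (I : Type) (r : seq I) (a b : I -> R) :
  \sum_(i <- r) (a i +i* b i)%C = ((\sum_(i <- r) a i) +i* (\sum_(i <- r) b i))%C.
Proof.
elim: r => [|i r IH]; first by rewrite !big_nil.
by rewrite !big_cons IH; simpc.
Qed.

Lemma symsum_odd (h : int -> R) N : (forall m, h (- m) = - h m) -> symsum h N = 0.
Proof.
move=> hN; have h0 : h 0 = 0 by have := hN 0; rewrite oppr0; lra.
by elim: N => [|N IH]; rewrite ?symsum0// symsumS IH hN subrr addr0.
Qed.

(** The imaginary part cancels because [U] is even. *)
Lemma symsum_expi N phi :
  \sum_(k < N.*2.+1) (expR (- U (k%:Z - N%:Z)))%:C%C *
    expi ((k%:Z - N%:Z)%:~R * phi) = (partial_G N phi)%:C%C.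
Proof.
have -> : (partial_G N phi)%:C%C =
    (partial_G N phi +i* symsum (fun m => expR (- U m) * sin (m%:~R * phi)) N)%C.
  rewrite symsum_odd// => m.
  by rewrite (annealed_gaussian_even hU) mulrNz mulNr sinN mulrN.
rewrite /partial_G /symsum -sum_complex; apply: eq_bigr => k _.
by rewrite /expi; simpc.
Qed.

(* The phases of the edges recombine into one phase per vertex.               *)
Lemma cos_prod_partial_G (E V : finType) (s t : E -> V) (k0 : V -> int) N theta :
  cos (angle k0 theta) * \prod_d partial_G N (theta (s d) - theta (t d)) =
  cos_sum (fun x : {ffun E -> 'I_(N.*2.+1)} => \prod_d expR (- U (box x d)))
    (fun x v => k0 v + \sum_d box x d * ((s d == v)%:Z - (t d == v)%:Z)) theta.
Proof.
have ReM (a : R) (z : R[i]) : complex.Re (a%:C%C * z) = a * complex.Re z.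
  by case: z => b c /=; rewrite mul0r subr0.
have -> : cos (angle k0 theta) * \prod_d partial_G N (theta (s d) - theta (t d)) =
    complex.Re ((\prod_d partial_G N (theta (s d) - theta (t d)))%:C%C * expi (angle k0 theta)).
  by rewrite ReM mulrC.
rewrite rmorph_prod/=; under eq_bigr do rewrite -symsum_expi.
rewrite bigA_distr_bigA /= mulr_suml.
have -> : (\sum_(f : {ffun E -> 'I_(N.*2.+1)})
    (\prod_i ((expR (- U ((f i)%:Z - N%:Z)))%:C%C *
      expi (((f i)%:Z - N%:Z)%:~R * (theta (s i) - theta (t i))))) * expi (angle k0 theta)) =
  \sum_(x : {ffun E -> 'I_(N.*2.+1)}) (((\prod_d expR (- U (box x d))) *
     cos (angle (fun v => k0 v + \sum_d box x d * ((s d == v)%:Z - (t d == v)%:Z)) theta))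
   +i* ((\prod_d expR (- U (box x d))) *
     sin (angle (fun v => k0 v + \sum_d box x d * ((s d == v)%:Z - (t d == v)%:Z)) theta)))%C.
  apply: eq_bigr => x _; rewrite big_split/= -rmorph_prod/= -expi_sum -mulrA -expiD.
  have -> : \sum_i ((x i)%:Z - N%:Z)%:~R * (theta (s i) - theta (t i)) + angle k0 theta =
      angle (fun v => k0 v + \sum_d box x d * ((s d == v)%:Z - (t d == v)%:Z)) theta.
    rewrite /angle addrC; under [RHS]eq_bigr do rewrite rmorphD/= mulrDl.
    rewrite big_split/=; congr (_ + _).
    under [RHS]eq_bigr do rewrite rmorph_sum/= mulr_suml.
    rewrite exchange_big/=; apply: eq_bigr => d _.
    have <- : box x d = (x d)%:Z - N%:Z by rewrite ffunE.
    have pick (v0 : V) : \sum_v (v0 == v)%:R * theta v = theta v0.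
      rewrite (bigD1 v0)//= eqxx mul1r big1 ?addr0// => v; rewrite eq_sym => /negPf ->.
      by rewrite mul0r.
    under [RHS]eq_bigr do rewrite rmorphM rmorphB/= -!pmulrn -mulrA mulrBl.
    by rewrite -mulr_sumr sumrB !pick.
  have -> : \prod_i expR (- U ((x i)%:Z - N%:Z)) = \prod_d expR (- U (box x d)).
    by apply: eq_bigr => d _; rewrite ffunE.
  by rewrite /expi; simpc.
by rewrite sum_complex.
Qed.

End SpinSeries.

Section Duality.
Variables (R : realType) (G : plane_graph) (U : int -> R).
Hypothesis hU : annealed_gaussian U.
Hypothesis hsum : (\esum_(m in [set: int]) (expR (- U m))%:E < +oo)%E.
Local Notation cw := (current_weight (G := G) U).

(** Selects the Fourier terms whose total frequency vanishes at every vertex. *)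
Definition sourced_weight (k0 : vert G -> int) (m : {ffun edge G -> int}) : R :=
  if [forall v, k0 v + divergence m v == 0] then cw m else 0.

Lemma sourced_weight_ge0 k0 m : 0 <= sourced_weight k0 m.
Proof. by rewrite /sourced_weight; case: ifP => // _; exact: current_weight_ge0. Qed.

Lemma current_weight_summable : summableR cw.
Proof.
apply: (@summable_prod _ _ (fun _ m => expR (- U m)) _ (fun=> total_weight U)).
  by move=> _ m; exact: expR_ge0.
by move=> _ N; exact: symsum_expR_le.
Qed.

Lemma sourced_weight_summable k0 : summableR (sourced_weight k0).
Proof.
apply: le_lt_trans current_weight_summable; apply: le_esum => m _.
rewrite lee_fin /sourced_weight; case: ifP => // _; exact: current_weight_ge0.
Qed.

(** Integrating the truncated expansion leaves the currents of zero frequency, with a factor $2\pi$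
    per vertex; the truncation is removed by [spin_integral_cvg] on one side and [boxsum_cvg] on the
    other. *)
Lemma spin_integral_total (k0 : vert G -> int) :
  spin_integral (enum (vert G))
    (fun theta => cos (angle k0 theta) * spin_density U theta) (fun=> 0) =
  (pi *+ 2) ^+ #|vert G| * total (sourced_weight k0).
Proof.
pose s (d : edge G) := source (val d); pose t (d : edge G) := target (val d).
pose c N (x : {ffun edge G -> 'I_(N.*2.+1)}) : R := \prod_d expR (- U (box x d)).
pose k N (x : {ffun edge G -> 'I_(N.*2.+1)}) v :=
  k0 v + \sum_d box x d * ((s d == v)%:Z - (t d == v)%:Z).
have c0 N x : 0 <= c N x by apply: prodr_ge0 => d _; exact: expR_ge0.
have cM N : \sum_x c N x <= \prod_(d : edge G) total_weight U.
  rewrite -[leLHS]/(boxsum (fun m : {ffun edge G -> int} => \prod_d expR (- U (m d))) N).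
  rewrite (boxsum_prod (fun _ m => expR (- U m))); apply: ler_prod => d _.
  rewrite symsum_expR_le// andbT; apply: sumr_ge0 => i _; exact: expR_ge0.
have cF theta : cos_sum (@c N) (@k N) theta @[N --> \oo] -->
    cos (angle k0 theta) * spin_density U theta.
  have -> : (fun N => cos_sum (@c N) (@k N) theta) = (fun N => cos (angle k0 theta) *
      \prod_(d : edge G) partial_G U N (theta (s d) - theta (t d))).
    by apply/funext => N; rewrite cos_prod_partial_G.
  apply: cvgM; first exact: cvg_cst.
  rewrite /spin_density big_sub.
  apply: cvg_big => [|d _]; first exact: mul_continuous.
  exact: partial_G_cvg.
have H := @spin_integral_cvg R (vert G) _ c k _ _ c0 cM cF (enum (vert G)) (fun=> 0).
apply: (cvg_unique _ H) => //.
have -> : (fun N => spin_integral (enum (vert G)) (cos_sum (@c N) (@k N)) (fun=> 0)) =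
    (fun N => (pi *+ 2) ^+ #|vert G| * boxsum (sourced_weight k0) N).
  apply/funext => N; rewrite spin_integral_cos_sum /cos_sum /boxsum mulr_sumr.
  apply: eq_bigr => x _.
  rewrite (_ : angle _ _ = 0) ?cos0 ?mulr1; last first.
    by rewrite /angle big1// => v _; rewrite mulr0.
  rewrite -cardE /sourced_weight.
  have -> : all (fun v => k N x v == 0) (enum (vert G)) =
      [forall v, k0 v + divergence (box x) v == 0].
    by apply/allP/forallP => [h v|h v _]; apply: h; rewrite mem_enum.
  by case: ifP; rewrite ?mulr0.
apply: cvgM; first exact: cvg_cst.
apply: boxsum_cvg; [exact: sourced_weight_ge0|exact: sourced_weight_summable].
Qed.

Definition pair_source (y x : vert G) (v : vert G) : int := (y == v)%:Z - (x == v)%:Z.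

Lemma spin_expectation_cos (x y : vert G) :
  spin_expectation U (fun theta => cos (theta x - theta y)) =
  total (sourced_weight (pair_source y x)) / total (sourced_weight (fun=> 0)).
Proof.
have pick theta (v0 : vert G) : \sum_v (v0 == v)%:R * theta v = theta v0 :> R.
  rewrite (bigD1 v0)//= eqxx mul1r big1 ?addr0// => v; rewrite eq_sym => /negPf ->.
  by rewrite mul0r.
have -> : spin_expectation U (fun theta => cos (theta x - theta y)) =
    spin_integral (enum (vert G)) (fun theta => cos (angle (pair_source y x) theta) *
      spin_density U theta) (fun=> 0) /
    spin_integral (enum (vert G)) (fun theta => cos (angle (fun=> 0) theta) *
      spin_density U theta) (fun=> 0).
  rewrite /spin_expectation; congr (_ / _);
    congr spin_integral; apply/funext => theta.
    (* With $\theta_y-\theta_x$ in the cosine, the selected currents have the divergence of a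
       gradient minus [cut gamma]. *)
    rewrite -cosN opprB; congr (cos _ * _).
    rewrite /angle /pair_source; under [RHS]eq_bigr do rewrite rmorphB/= -!pmulrn mulrBl.
    by rewrite sumrB !pick.
  by rewrite /angle big1 ?cos0 ?mul1r// => v _; rewrite mul0r.
rewrite !spin_integral_total invfM mulrACA divff ?mul1r//.
by rewrite expf_neq0// mulrn_eq0/= gt_eqF// pi_gt0.
Qed.

Lemma total_sourceless_gt0 : 0 < total (sourced_weight (fun=> 0)).
Proof.
have sfin := esum_fin_num (sourced_weight_ge0 (fun=> 0)) (sourced_weight_summable (fun=> 0)).
rewrite /total -lte_fin fineK//.
apply: (@lt_le_trans _ _ (\sum_(n \in [set [ffun=> 0 : int]]) (sourced_weight (fun=> 0) n)%:E)%E).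
  rewrite fsbig_set1 lte_fin /sourced_weight ifT.
    by apply: prodr_gt0 => d _; exact: expR_gt0.
  apply/forallP => v; rewrite add0r /divergence big1// => d _.
  by rewrite ffunE mul0r.
by apply: esum_ge; exists [set [ffun=> 0]].
Qed.

(** By [divergence_exact] each sourceless current is the gradient of a height function. *)
Lemma total_sourceless_le :
  ((total (sourced_weight (fun=> 0)))%:E <=
   \esum_(n in [set: height G]) (height_weight U n)%:E)%E.
Proof.
rewrite /total fineK; last first.
  by apply: esum_fin_num; [exact: sourced_weight_ge0|exact: sourced_weight_summable].
have -> : (\esum_(n in [set: height G]) (height_weight U n)%:E =
    \esum_(m in (fun n : height G => hgrad (val n)) @` setT) (cw m)%:E)%E.
  rewrite esum_image; last first.
    move=> n n' _ _ nn'; apply: val_inj; apply: (grad_inj (f0 := outer G)) nn' _.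
      by move=> h hE f; exact: face_const.
    by rewrite (eqP (valP n)) (eqP (valP n')).
  by apply: eq_esum => n _; rewrite height_weightE.
rewrite [leRHS]esum_mkcond; apply: le_esum => m _.
rewrite /sourced_weight; case: ifPn => [/forallP div0|_]; last first.
  by case: ifP => // _; rewrite lee_fin; exact: current_weight_ge0.
rewrite ifT//; apply/mem_set.
have [n nm n0] : exists2 n, hgrad n = m & n (outer G) = 0.
  by apply: divergence_exact => v; have /eqP := div0 v; rewrite add0r.
by exists (exist _ n (introT eqP n0)).
Qed.

Lemma height_weight_summable (A : set (height G)) :
  (\esum_(n in A) (height_weight U n)%:E < +oo)%E.
Proof.
apply: (@le_lt_trans _ _ (\esum_(m in [set: {ffun edge G -> int}]) (cw m)%:E)%E);
  last exact: current_weight_summable.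
under eq_esum do rewrite height_weightE.
rewrite -(esum_image A (fun n : height G => hgrad (val n)) (fun m => (cw m)%:E)).
  exact: subset_le_esum.
move=> n n' _ _ nn'; apply: val_inj; apply: (grad_inj (f0 := outer G)) nn' _.
  by move=> h hE f; exact: face_const.
by rewrite (eqP (valP n)) (eqP (valP n')).
Qed.

(** The contributions of the darts telescope along the walk; as the path is simple, each dart is
    counted once. *)
Lemma divergence_cut (gamma : seq (dart G)) (x y : vert G) v :
  simple_path y gamma x -> divergence (cut gamma) v = pair_source y x v.
Proof.
move=> /andP[wg ug].
have ug' : uniq gamma by move: ug => /= /andP[_ /map_uniq].
transitivity (\sum_(d : dart G)
    ((d \in gamma)%:Z - (rev d \in gamma)%:Z) * (source d == v)%:Z).
  rewrite sum_darts; apply: eq_bigr => d _.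
  by rewrite ffunE rev_invol /target; ring.
under eq_bigr do rewrite mulrBl.
rewrite sumrB [X in _ - X](reindex_inj (inv_inj (@rev_invol G)))/=.
under [X in _ - X]eq_bigr do rewrite rev_invol -/(target _).
have sumE (h : dart G -> int) : \sum_d (d \in gamma)%:Z * h d = \sum_(d <- gamma) h d.
  rewrite (big_uniq _ ug') [RHS]big_mkcond/=; apply: eq_bigr => d _.
  by case: (d \in gamma); rewrite ?mul1r ?mul0r.
rewrite !sumE /pair_source -sumrB.
elim: gamma y wg {ug ug' sumE} => [|d p IH] y /=.
  by move=> /eqP ->; rewrite big_nil subrr.
by move=> /andP[/eqP <- /IH pE]; rewrite big_cons pE; ring.
Qed.

(** Taking the gradient and subtracting [cut gamma] is injective on height functions, which are
    pinned at the outer face, and gives the divergence opposite to [pair_source y x]. *)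
Lemma cut_sum_le (gamma : seq (dart G)) (x y : vert G) (A : set (height G)) :
  simple_path y gamma x ->
  (\esum_(n in A) (cw [ffun d => hgrad (val n) d - cut gamma d])%:E <=
   (total (sourced_weight (pair_source y x)))%:E)%E.
Proof.
move=> hgamma; rewrite /total fineK; last first.
  by apply: esum_fin_num; [exact: sourced_weight_ge0|exact: sourced_weight_summable].
pose g (n : height G) : {ffun edge G -> int} := [ffun d => hgrad (val n) d - cut gamma d].
have gE n : cw (g n) = sourced_weight (pair_source y x) (g n).
  rewrite /sourced_weight ifT//; apply/forallP => v.
  have -> : divergence (g n) v = divergence (hgrad (val n)) v - divergence (cut gamma) v.
    by rewrite /divergence -sumrB; apply: eq_bigr => d _; rewrite ffunE mulrBl.
  by rewrite divergence_grad sub0r (divergence_cut v hgamma) subrr.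
under eq_esum do rewrite -/(g _) gE.
rewrite -(esum_image A g (fun m => (sourced_weight (pair_source y x) m)%:E)).
  exact: subset_le_esum.
move=> n n' _ _ /ffunP gg'; apply: val_inj; apply: (grad_inj (l := @edge_left G)
  (r := @edge_right G) (f0 := outer G)).
- by move=> h hE f; exact: face_const.
- by apply/ffunP => d; have := gg' d; rewrite !ffunE => /addIr.
- by rewrite (eqP (valP n)) (eqP (valP n')).
Qed.

End Duality.

(** * The correlation inequality *)

Theorem theorem10p3 (R : realType) (G : plane_graph) (U : int -> R)
    (hU : annealed_gaussian U)
    (hsum : (\esum_(m in [set: int]) (expR (- U m))%:E < +oo)%E)
    (x y : vert G) (hxy : x != y)
    (gamma : seq (dart G)) (hgamma : simple_path y gamma x)
    (e : dart G) (hex : source e = x)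
    (hex' : target e \notin walk_verts y gamma) :
  (forall q : rat, half_integer q ->
     height_prob U [set n : height G | level_event gamma e y q n] <=
     spin_expectation U (fun theta => cos (theta x - theta y))) /\
  (forall qt : height G -> rat,
     (forall n, half_integer (qt n)) ->
     (forall n n' : height G,
        [set val n (left e); val n (right e)] =
        [set val n' (left e); val n' (right e)] -> qt n = qt n') ->
     height_prob U [set n : height G | level_event gamma e y (qt n) n] <=
     spin_expectation U (fun theta => cos (theta x - theta y))).
Proof.
suff main : forall qt : height G -> rat, (forall n, half_integer (qt n)) ->
     (forall n n' : height G,
        [set val n (left e); val n (right e)] =
        [set val n' (left e); val n' (right e)] -> qt n = qt n') ->
     height_prob U [set n : height G | level_event gamma e y (qt n) n] <=
     spin_expectation U (fun theta => cos (theta x - theta y)).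
  (* A fixed $q$ is a constant choice of [qt]. *)
  by split=> // q hq; exact: (main (fun=> q)).
move=> qt qt_half qt_pair; rewrite spin_expectation_cos// /height_prob.
set A := [set n | _].
have w_ge0 (n : height G) : 0 <= height_weight U n by rewrite height_weightE current_weight_ge0.
have fin (B : set (height G)) : (\esum_(n in B) (height_weight U n)%:E)%E \is a fin_num.
  by apply: esum_fin_num => //; exact: height_weight_summable.
have Z0 := total_sourceless_gt0 G hsum.
have le_Z : total (@sourced_weight R G U (fun=> 0)) <=
    fine (\esum_(n in [set: height G]) (height_weight U n)%:E)%E.
  by rewrite -lee_fin [leRHS]fineK//; exact: total_sourceless_le.
have le_A : fine (\esum_(n in A) (height_weight U n)%:E)%E <=
    total (sourced_weight U (pair_source y x)).
  rewrite -lee_fin [leLHS]fineK//; apply: (le_trans (level_sum_le hU gamma y qt_half qt_pair)).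
  exact: cut_sum_le.
have A_ge0 : 0 <= fine (\esum_(n in A) (height_weight U n)%:E)%E.
  by apply: fine_ge0; apply: esum_ge0 => n _; rewrite lee_fin.
apply: (@le_trans _ _ (fine (\esum_(n in A) (height_weight U n)%:E)%E /
    total (@sourced_weight R G U (fun=> 0)))).
  rewrite ler_wpM2l// lef_pV2// posrE//; exact: lt_le_trans le_Z.
by rewrite ler_wpM2r// invr_ge0 ltW.
Qed.
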